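(* Let $G$ be a countable discrete or profinite group acting faithfully by automorphisms on a spherically homogeneous rooted tree $T$ (all of whose levels are finite and which has no leaves), and hence by homeomorphisms on its boundary $X=\partial T$. Let $Y=\partial T_G$ be the boundary of the corresponding orbit tree $T_G$. Then: (a) For every $\eta\in Y$ the uniform probability measure $\mu_\eta$ with support $\partial T_\eta$ belongs to $\mathcal{M}^e_G$, and the map $\beta\colon Y\to\mathcal{M}^e_G$, $\beta(\eta)=\mu_\eta$, is a homeomorphism. (b) The map $\pi=\beta\circ\psi\colon X\to\mathcal{M}^e_G$, which sends a point $\xi\in X$ to the uniform probability measure $\mu_{\psi(\xi)}$ with support $\partial T_\xi=\partial T_{\psi(\xi)}$, is a Borel surjection satisfying the following conditions, and thus defines the ergodic decomposition of the action of $G$ on $X$: 1) $\pi$ is $G$-invariant, i.e. constant on each orbit of $G$; 2) for each $\nu\in\mathcal{M}^e_G$ the set $X_\nu=\{x\in X : \pi(x)=\nu\}$ satisfies $\nu(X_\nu)=1$, and the action of $G$ on $X_\nu$ has a unique invariant probability measure, namely $\nu$; 3) if $\mu\in\mathcal{M}_G$, then $\mu=\int_X\pi(\xi)\,d\mu(\xi)$, i.e. $\mu(A)=\int_X \bigl(\pi(\xi)\bigr)(A)\,d\mu(\xi)$ for every Borel set $A\subseteq X$.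
   Context: A rooted tree $T$ is a tree with a distinguished vertex (root); $[T]_n$ denotes its $n$-th level, the set of vertices at distance $n$ from the root. The children of a vertex of level $n$ are the vertices of level $n+1$ adjacent to it. $T$ is spherically homogeneous if all vertices of each level have the same degree (which may depend on the level). All rooted trees have no leaves: every vertex lies on some infinite non-backtracking path starting at the root. The boundary $\partial T$ is the set of infinite non-backtracking paths from the root; for $\xi\in\partial T$, $[\xi]_n$ is the vertex of level $n$ on $\xi$. For a vertex $v$, the cylinder set $C_v\subseteq\partial T$ consists of all paths through $v$; the sets $C_v$ form a basis of the topology on $\partial T$ (equivalently, the topology comes from the metric in which the distance between two distinct points whose longest common initial path has length $k$ is $\lambda_k$, for a fixed decreasing sequence of positive numbers $\lambda_n\to0$), and $\partial T$ carries the Borel structure of this topology. Automorphisms of $T$ preserve the root (hence the levels). The orbit tree $T_G$ is the graph whose vertices are the orbits of $G$ on the levels of $T$, two orbits being adjacent iff they contain vertices adjacent in $T$; it is a rooted tree whose root is the orbit of the root of $T$. The map $\psi$ sends a vertex of $T$ to its $G$-orbit viewed as a vertex of $T_G$, and extends to $\psi\colon\partial T\to\partial T_G$. For $\eta\in\partial T_G$, $T_\eta$ is the subtree of $T$ with vertex set $\psi^{-1}(\{[\eta]_n : n\ge0\})$, i.e. the union over $n$ of the orbits $[\eta]_n$; for $\xi\in\partial T$, $T_\xi=T_{\psi(\xi)}$. The group $G$ acts transitively on each level of $T_\eta$. The uniform probability measure $\mu_\eta$ is the Borel probability measure on $\partial T$ with $\mu_\eta(C_v)=1/|[T_\eta]_n|$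 if $v$ is a level $n$ vertex of $T_\eta$ and $\mu_\eta(C_v)=0$ if $v$ is not a vertex of $T_\eta$. $\mathcal{M}_G$ is the set of all $G$-invariant Borel probability measures on $\partial T$, and $\mathcal{M}^e_G\subseteq\mathcal{M}_G$ is the set of ergodic ones, where an invariant probability measure $\mu$ is ergodic if every $G$-invariant Borel set has $\mu$-measure $0$ or $1$. Both are endowed with the weak topology: $\mu_n\to\mu$ iff $\int f\,d\mu_n\to\int f\,d\mu$ for every bounded continuous $f\colon\partial T\to\mathbb{R}$. *)

(* Defs.v *)
From HB Require Import structures.
From mathcomp Require Import all_boot all_order all_algebra finmap.
From mathcomp Require Import zify.
From mathcomp Require Import all_classical all_reals all_analysis.
Import Order.TTheory GRing.Theory Num.Theory.
Import numFieldNormedType.Exports.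

Set Implicit Arguments.
Unset Strict Implicit.
Unset Printing Implicit Defensive.

Local Open Scope classical_set_scope.
Local Open Scope ring_scope.

Record rootedGraph := RootedGraph {
  vertex :> choiceType;
  adj : rel vertex;
  root : vertex }.
Arguments root : clear implicits.

Section RootedGraph.
Variable T : rootedGraph.

Definition walk_to (n : nat) (v : T) : Prop :=
  exists p : seq T,
    [/\ path (@adj T) (root T) p, last (root T) p = v & size p = n].

Definition level (n : nat) : set T :=
  [set v | walk_to n v /\ forall m, walk_to m v -> (n <= m)%N].

Definition neighbours (v : T) : set T := [set w | adj v w].

Definition ray (p : nat -> T) : Prop :=
  [/\ p 0%N = root T,
      forall n, adj (p n) (p n.+1) &
      forall n, p n.+2 != p n].

Definition boundary : Type := set_type [set p : nat -> T | ray p].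

HB.instance Definition _ := Choice.on boundary.

Definition vertex_at (xi : boundary) : nat -> T := \val xi.

Definition cylinder (v : T) : set boundary :=
  [set xi | exists n, vertex_at xi n = v].

(* In a tree two cylinders are nested or disjoint, so that the cylinders are
   in fact a basis of the topology that they generate. *)
HB.instance Definition _ :=
  isSubBaseTopological.Build boundary (range cylinder) (@id (set boundary)).

End RootedGraph.

Coercion vertex_at : boundary >-> Funclass.

Record rootedTree := RootedTree {
  graph_of_tree :> rootedGraph;
  adj_sym : symmetric (@adj graph_of_tree);
  adj_irr : irreflexive (@adj graph_of_tree);
  adj_connected : forall v w : graph_of_tree,
    exists p, path (@adj graph_of_tree) v p /\ last v p = w;
  (* an edge traversed back and forth is a [ucycle] of size 2 *)
  adj_acyclic : forall c : seq graph_of_tree,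
    ucycle (@adj graph_of_tree) c -> (size c <= 2)%N;
  no_leaf : forall v : graph_of_tree,
    exists2 p, ray p & exists n, p n = v }.

Definition spherically_homogeneous (T : rootedGraph) : Prop :=
  forall n (v w : T), level n v -> level n w ->
    (neighbours v #= neighbours w)%card.

Definition finite_levels (T : rootedGraph) : Prop :=
  forall n, finite_set (@level T n).

Section RootedTree.
Variable T : rootedTree.

Lemma boundary_nonempty : exists xi : boundary T, True.
Proof.
have [p rp _] := no_leaf (root T).
by exists (exist _ p (mem_set rp)).
Qed.

HB.instance Definition _ :=
  isPointed.Build (boundary T) (projT1 (cid boundary_nonempty)).

Lemma path_walk (w : nat -> T) m i :
  (forall k, (i <= k < i + m)%N -> adj (w k) (w k.+1)) ->
  path (@adj T) (w i) [seq w k | k <- iota i.+1 m].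
Proof.
elim: m i => [//|m IH] i aw /=; rewrite aw ?leqnn ?addnS ?ltnS ?leq_addr//=.
apply: IH => k /andP[ik km]; apply: aw; rewrite (ltnW ik)/=.
by rewrite addnS -addSn.
Qed.

Lemma nonbacktracking_inj (w : nat -> T) L :
  (forall i, (i < L)%N -> adj (w i) (w i.+1)) ->
  (forall i, (i.+1 < L)%N -> w i.+2 != w i) ->
  forall d i, (i + d.+1 <= L)%N -> w (i + d.+1)%N != w i.
Proof.
move=> aw nw; elim/ltn_ind => d IH i idL; apply/eqP => wE.
have ltw k l : (i <= k)%N -> (k < l)%N -> (l <= i + d)%N -> w l != w k.
  move=> ik kl ld; have -> : l = (k + (l - k.+1).+1)%N.
    by rewrite addnS -addSn subnKC.
  apply: IH; first by rewrite ltn_subLR// (leq_ltn_trans ld)// ltn_add2r.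
  by rewrite addnS -addSn subnKC// (leq_trans ld)// ltnW// -addnS.
have/adj_acyclic : ucycle (@adj T) [seq w k | k <- iota i d.+1].
  apply/andP; split.
    rewrite /= -wE -map_rcons.
    have -> : rcons (iota i.+1 d) (i + d.+1) = iota i.+1 d.+1.
      by rewrite -[d.+1 in RHS]addn1 iotaD/= cats1 addSnnS.
    rewrite wE; apply: path_walk => k /andP[_ kd].
    by apply: aw; exact: leq_trans idL.
  rewrite map_inj_in_uniq ?iota_uniq// => k l.
  rewrite !mem_iota !addnS !ltnS => /andP[ik kd] /andP[il ld] wkl.
  case: (ltngtP k l) => // [kl|lk].
    by have := ltw _ _ ik kl ld; rewrite wkl eqxx.
  by have := ltw _ _ il lk kd; rewrite wkl eqxx.
rewrite size_map size_iota; case: d {IH ltw} idL wE => [|[|//]] idL wE _.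
  by move: (aw i); rewrite addn1 in idL wE; rewrite wE adj_irr => /(_ idL).
by move: (nw i); rewrite addn2 in idL wE; rewrite wE eqxx => /(_ idL).
Qed.

Lemma vertex_at_level (p q : nat -> T) m n :
  ray p -> ray q -> p m = q n -> m = n.
Proof.
move=> rp rq; elim: n m => [|n IH] m.
  case: m => // m pq; case: rp => p0 ap np; case: rq => q0 _ _.
  have := @nonbacktracking_inj p m.+1 (fun i _ => ap i) (fun i _ => np i) m 0%N.
  by rewrite add0n leqnn pq p0 q0 eqxx => /(_ isT).
case: m => [pq|m pq].
  case: rq => q0 aq nq; case: rp => p0 _ _.
  have := @nonbacktracking_inj q n.+1 (fun i _ => aq i) (fun i _ => nq i) n 0%N.
  by rewrite add0n leqnn -pq p0 q0 eqxx => /(_ isT).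
have [pqE|pqN] := eqVneq (p m) (q n); first by congr _.+1; exact: IH.
exfalso; case: rp => p0 ap np; case: rq => q0 aq nq.
pose w i := if (i <= m.+1)%N then p i else q (m.+1 + n.+1 - i)%N.
have wq i : (m.+1 <= i)%N -> w i = q (m.+1 + n.+1 - i)%N.
  move=> mi; rewrite /w; case: ifP => // im.
  have -> : i = m.+1 by apply/eqP; rewrite eqn_leq im.
  by rewrite addKn pq.
have wp i : (i <= m.+1)%N -> w i = p i by rewrite /w => ->.
have := @nonbacktracking_inj w (m.+1 + n.+1) _ _ (m.+1 + n) 0%N.
rewrite add0n -addnS leqnn wq ?leq_addr// subnn wp// p0 q0 eqxx.
move=> H; suff: false by [].
apply: H => // i iL.
  have [im|mi] := ltnP i m.+1; first by rewrite !wp// ltnW.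
  rewrite !wq ?(leq_trans mi)// adj_sym.
  have -> : (m.+1 + n.+1 - i = (m.+1 + n.+1 - i.+1).+1)%N by rewrite subnSK.
  exact: aq.
have [im|mi] := ltnP i.+1 m.+1; first by rewrite !wp// ltnW// ltnW.
have [im|mi'] := ltnP i m.+1.
  have -> : i = m by lia.
  rewrite wq// wp//; have -> : (m.+1 + n.+1 - m.+2 = n)%N by lia.
  by rewrite eq_sym.
rewrite !wq//; last by lia.
have -> : (m.+1 + n.+1 - i = (m.+1 + n.+1 - i.+2).+2)%N.
  by lia.
by rewrite eq_sym.
Qed.

End RootedTree.

HB.mixin Record PreTopologicalGroup_isTopologicalGroup G
    & Group G & Topological G := {
  mulg_continuous : continuous (fun x : G * G => (x.1 * x.2)%g) ;
  invg_continuous : continuous (fun x : G => x^-1%g) }.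

#[short(type="topologicalGroupType")]
HB.structure Definition TopologicalGroup :=
  {G of Group G & Topological G & PreTopologicalGroup_isTopologicalGroup G}.

Definition countable_discrete (G : topologicalGroupType) : Prop :=
  countable [set: G] /\ forall A : set G, open A.

Definition profinite (G : topologicalGroupType) : Prop :=
  [/\ compact [set: G], hausdorff_space G & totally_disconnected [set: G]].

Record treeAction (G : groupType) (T : rootedGraph) := TreeAction {
  act :> G -> T -> T;
  act1 : forall v, act 1%g v = v;
  actM : forall g h v, act (g * h)%g v = act g (act h v);
  act_adj : forall g v w, adj (act g v) (act g w) = adj v w;
  act_root : forall g, act g (root T) = root T }.

Definition faithful (G : groupType) (T : rootedGraph) (a : treeAction G T) :
    Prop :=
  forall g, (forall v, a g v = v) -> g = 1%g.

Definition continuous_action (G : topologicalGroupType) (T : rootedGraph)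
    (a : treeAction G T) : Prop :=
  continuous (fun gv : G * discrete_topology T =>
                (a gv.1 gv.2 : discrete_topology T)).

Section OrbitTree.
Variables (G : groupType) (T : rootedTree) (a : treeAction G T).

Definition orbit_of (v : T) : set T := [set a g v | g in [set: G]].

Definition orbit_vertex : Type := set_type (range orbit_of).

HB.instance Definition _ := Choice.on orbit_vertex.

Definition psi (v : T) : orbit_vertex :=
  exist _ (orbit_of v) (mem_set (imageT orbit_of v)).

Definition orbit_adj (O O' : orbit_vertex) : bool :=
  `[< exists v w, [/\ \val O v, \val O' w & adj v w] >].

Definition orbit_tree : rootedGraph :=
  @RootedGraph orbit_vertex orbit_adj (psi (root T)).

Lemma orbit_of_self v : orbit_of v v.
Proof. by exists 1%g; rewrite ?act1. Qed.

Lemma ray_act g p : ray p -> ray (fun n => a g (p n)).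
Proof.
move=> [p0 ap np]; split=> [|n|n]; first by rewrite p0 act_root.
  by rewrite act_adj.
apply: contra (np n) => /eqP/(congr1 (a g^-1%g)).
by rewrite -!actM mulVg !act1 => ->.
Qed.

Definition act_boundary (g : G) (xi : boundary T) : boundary T :=
  exist _ (fun n => a g (xi n)) (mem_set (ray_act g (set_mem (valP xi)))).

Lemma ray_psi (p : nat -> T) : ray p -> ray (psi \o p : nat -> orbit_tree).
Proof.
move=> rp; have [p0 ap np] := rp; split=> [|n|n]; first by rewrite /= p0.
  apply/asboolP; exists (p n), (p n.+1).
  by split; [exact: orbit_of_self|exact: orbit_of_self|exact: ap].
apply/eqP => /(congr1 (@sval _ _)) /= oE.
have [g _ gE] : orbit_of (p n) (p n.+2) by rewrite -oE; exact: orbit_of_self.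
have /eqP := vertex_at_level (ray_act g rp) rp gE.
by rewrite -addn2 -{1}[n]addn0 eqn_add2l.
Qed.

Definition psi_boundary (xi : boundary T) : boundary orbit_tree :=
  exist _ (psi \o xi : nat -> orbit_tree)
    (mem_set (ray_psi (set_mem (valP xi)))).

Definition subtree (eta : boundary orbit_tree) : set T :=
  psi @^-1` range (vertex_at eta).

Definition subtree_boundary (eta : boundary orbit_tree) : set (boundary T) :=
  [set xi | forall n, subtree eta (xi n)].

End OrbitTree.

Notation borel X := (g_sigma_algebraType (@open X)).

Section BorelProbability.
Variables (X : ptopologicalType) (R : realType).

Lemma eq_prob d (S : measurableType d) (m1 m2 : probability S R) :
  (m1 = m2 :> (set S -> \bar R)) -> m1 = m2.
Proof.
case: m1 m2 => [m1 [[c1 c2] [c3] [c4] [c5] [c6] [c7] [c8]]].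
case=> [m2 [[d1 d2] [d3] [d4] [d5] [d6] [d7] [d8]]] /= m12; subst m2.
rewrite (Prop_irrelevance d1 c1) (Prop_irrelevance d2 c2) in d3 *.
rewrite (Prop_irrelevance d3 c3) (Prop_irrelevance d4 c4).
rewrite (Prop_irrelevance d5 c5) (Prop_irrelevance d6 c6).
by rewrite (Prop_irrelevance d7 c7) (Prop_irrelevance d8 c8).
Qed.

(* An element of [probability (borel X) R] is a function on all subsets of [X]
   that is unconstrained on the subsets that are not Borel.  Prescribing the
   value 0 there selects exactly one such function for each Borel probability
   measure, so that Leibniz equality is equality of Borel measures. *)
Definition borel_probability : Type :=
  set_type [set mu : probability (borel X) R |
             forall A, ~ measurable A -> mu A = 0%E].

HB.instance Definition _ := Choice.on borel_probability.

Definition measure_of (mu : borel_probability) : probability (borel X) R :=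
  \val mu.

(* Existence and uniqueness of the normalised representative. *)
Section Normalisation.
Variable mu : probability (borel X) R.

Definition borel_restriction (A : set (borel X)) : \bar R :=
  if `[< measurable A >] then mu A else 0%E.

Let borel_restriction0 : borel_restriction set0 = 0%E.
Proof. by rewrite /borel_restriction measure0 if_same. Qed.

Let borel_restriction_ge0 A : (0 <= borel_restriction A)%E.
Proof. by rewrite /borel_restriction; case: ifP. Qed.

Let borel_restriction_sigma_additive : semi_sigma_additive borel_restriction.
Proof.
move=> F mF tF mUF; rewrite /borel_restriction (asboolT mUF).
under eq_fun do under eq_bigr do rewrite (asboolT (mF _)).
exact: measure_semi_sigma_additive.
Qed.

HB.instance Definition _ := isMeasure.Build _ _ _ borel_restriction
  borel_restriction0 borel_restriction_ge0 borel_restriction_sigma_additive.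

Let borel_restriction_setT : borel_restriction setT = 1%E.
Proof.
by rewrite /borel_restriction (asboolT measurableT) probability_setT.
Qed.

HB.instance Definition _ := Measure_isProbability.Build _ _ _ borel_restriction
  borel_restriction_setT.

Lemma borel_probability_unique :
  exists! nu : borel_probability,
    forall A : set (borel X), measurable A -> measure_of nu A = mu A.
Proof.
have P A : ~ measurable A -> borel_restriction A = 0%E.
  by move=> /asboolF; rewrite /borel_restriction => ->.
exists (exist _ (borel_restriction : probability (borel X) R) (mem_set P)).
split=> [A mA|nu nuE]; first by rewrite /= /borel_restriction (asboolT mA).
apply/val_inj/eq_prob/funext => A /=; rewrite /borel_restriction.
case: asboolP => [mA|nmA]; first by rewrite -nuE.
by rewrite (set_mem (valP nu)).
Qed.

End Normalisation.

HB.instance Definition _ := isPointed.Build borel_probability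
  (projT1 (cid (borel_probability_unique (\d_(point : borel X))))).

Definition bounded_continuous : Type :=
  set_type [set f : X -> R | continuous f /\ [bounded f x | x in [set: X]]].

(* The weak topology is the coarsest one for which every
   [fun mu => \int[mu]_x f x], with [f] bounded and continuous, is continuous. *)
Definition integrals (mu : borel_probability) :
    prod_topology (fun _ : bounded_continuous => R) :=
  fun f => (\int[measure_of mu]_x (\val f x))%R.

HB.instance Definition _ :=
  Topological.copy borel_probability (initial_topology integrals).

Definition measure_support (mu : borel_probability) : set X :=
  [set x | forall U, open_nbhs x U -> (0 < measure_of mu U)%E].

End BorelProbability.

Coercion measure_of : borel_probability >-> Probability.type.

(* [set_type] carries the subspace topology, so this applies to a map into a
   subset of a space. *)
Definition homeomorphism (X Y : topologicalType) (f : X -> Y) : Prop :=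
  continuous f /\
  exists g : Y -> X, [/\ cancel f g, cancel g f & continuous g].

Section InvariantMeasures.
Variables (R : realType) (G : groupType) (T : rootedTree).
Variable a : treeAction G T.

Definition invariant_measures : set (borel_probability (boundary T) R) :=
  [set mu | forall g (A : set (borel (boundary T))), measurable A ->
    mu (act_boundary a g @^-1` A) = mu A].

Definition invariant_set (A : set (boundary T)) : Prop :=
  forall g, act_boundary a g @^-1` A = A.

Definition ergodic_measures : set (borel_probability (boundary T) R) :=
  [set mu | invariant_measures mu /\
    forall A : set (borel (boundary T)), measurable A -> invariant_set A ->
      mu A = 0%E \/ mu A = 1%E].

Definition uniform_on (eta : boundary (orbit_tree a)) :
    set (borel_probability (boundary T) R) :=
  [set mu |
    (forall n v, level n v -> subtree eta v ->
      mu (cylinder v) =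
        ((#|` fset_set (level n `&` subtree eta)|%:R)^-1 : R)%:E) /\
    (forall v, ~ subtree eta v -> mu (cylinder v) = 0%E)].

(* [get] returns the unique element of [uniform_on eta] when there is one and an
   arbitrary measure otherwise. *)
Definition uniform_measure (eta : boundary (orbit_tree a)) :
    borel_probability (boundary T) R :=
  get (uniform_on eta).

End InvariantMeasures.

Arguments invariant_measures R [G T] a.
Arguments ergodic_measures R [G T] a.
Arguments uniform_on R [G T a] eta.
Arguments uniform_measure R [G T a] eta.

(* Main.v *)
(* Every boundary point of the orbit tree lifts to a ray of T, since an orbit
   adjacent to the orbit of v contains a neighbour of v.  An invariant measure
   gives equal mass to the cylinders of one orbit; hence an invariant
   probability carried by the orbits [eta]_n is mu_eta, and an ergodic one is
   carried by a single orbit on each level, hence by a single eta.  Borel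
   measures are determined by their values on cylinders, which gives uniqueness,
   ergodicity (compare B |-> mu(A /\ B) with mu(A) mu for A invariant) and, by
   Dynkin's lemma, the integral formula.

   The measure mu_eta is the image of Lebesgue measure on [0, 1[ under the map
   reading off the mixed-radix digits of x, the n-th radix being the number of
   children in [eta]_(n+1) of a vertex of [eta]_n.

   A continuous function on the boundary is uniformly continuous by Koenig's
   lemma, and measures mu_eta and mu_eta' with [eta]_n = [eta']_n agree on the
   level n cylinders, so eta |-> mu_eta is continuous.  Its inverse is
   continuous because the rays through a given orbit form a clopen set, of mass
   0 or 1 for an ergodic measure, so that mass 1 is the weakly open condition
   of mass > 1/2. *)

Require Import Defs.
From HB Require Import structures.
From mathcomp Require Import all_boot all_order all_algebra finmap.
From mathcomp Require Import zify lra.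
From mathcomp Require Import all_classical all_reals all_analysis measurable_realfun.
Import Order.TTheory GRing.Theory Num.Theory.
Import numFieldNormedType.Exports.

Set Implicit Arguments.
Unset Strict Implicit.
Unset Printing Implicit Defensive.

Local Open Scope classical_set_scope.
Local Open Scope ring_scope.

(** * Levels of a rooted tree *)

Section Levels.
Variable T : rootedTree.
Implicit Types (p q r : nat -> T) (v w : T) (xi zeta : boundary T).

Lemma ray_vertex_at xi : ray xi.
Proof. exact: set_mem (valP xi). Qed.

Lemma boundary_of_ray p : ray p -> exists xi, (xi : nat -> T) = p.
Proof. by move=> rp; exists (exist _ p (mem_set rp)). Qed.

Lemma boundary_through v : exists xi n, xi n = v.
Proof.
have [p /boundary_of_ray[xi <-] [n pn]] := no_leaf v.
by exists xi, n.
Qed.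

Lemma vertex_at_inj xi zeta m n : xi m = zeta n -> m = n.
Proof. exact: vertex_at_level (ray_vertex_at xi) (ray_vertex_at zeta). Qed.

(** Follow [q] up to [j], then [r] from [i] on. If this turns back at the new edge, then
    [r i.+1 = q j] or [q j.-1 = r i], and comparing levels gives [j = i.+1]; otherwise it is a ray,
    on which [r i] has index [j.+1]. *)
Lemma adj_ray_level q r i j :
  ray q -> ray r -> adj (q j) (r i) -> i = j.+1 \/ j = i.+1.
Proof.
move=> rq rr qr; have [rqE|rqN] := eqVneq (r i.+1) (q j).
  by right; rewrite (vertex_at_level rr rq rqE).
have [/andP[j0 /eqP rqE]|jN] := boolP ((0 < j)%N && (q j.-1 == r i)).
  by right; rewrite -(vertex_at_level rq rr rqE) prednK.
left; pose w k := if (k <= j)%N then q k else r (k + i - j.+1)%N.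
have wl k : (k <= j)%N -> w k = q k by rewrite /w => ->.
have wr k : (j < k)%N -> w k = r (k + i - j.+1)%N.
  by rewrite /w ltnNge; case: leq.
have rw : ray w.
  have [q0 aq nq] := rq; have [r0 ar nr] := rr.
  split=> [|k|k]; first by rewrite wl.
    have [kj|jk] := ltnP k j; first by rewrite !wl// ltnW.
    have [jk'|kj] := ltnP j k.
      rewrite !wr ?(leqW jk')//.
      by have -> : (k.+1 + i - j.+1 = (k + i - j.+1).+1)%N by lia.
    have -> : k = j by lia.
    by rewrite wl// wr// addSn subSS addnC addnK.
  have [kj|jk] := ltnP k.+1 j; first by rewrite !wl//; lia.
  have [jk'|kj] := ltnP j k.
    rewrite !wr ?(leqW (leqW jk'))//.
    by have -> : (k.+2 + i - j.+1 = (k + i - j.+1).+2)%N by lia.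
  rewrite wr; last lia.
  rewrite wl//.
  have [kE|kE] : k = j \/ j = k.+1 by lia.
    by rewrite kE; have -> : (j.+2 + i - j.+1 = i.+1)%N by lia.
  have -> : (k.+2 + i - j.+1 = i)%N by lia.
  by rewrite eq_sym; apply: contraNneq jN => <-; rewrite kE eqxx.
have -> : i = (j.+1 + i - j.+1)%N by lia.
by apply: (vertex_at_level rr rw); rewrite wr//; congr r; lia.
Qed.

(** If the parents differed, going out along [p] to level [n.+1] and back along [q] would be a
    closed walk without backtracking of length [n.+1.*2] at the root, against
    [nonbacktracking_inj]. *)
Lemma ray_parent p q n : ray p -> ray q -> p n.+1 = q n.+1 -> p n = q n.
Proof.
move=> [p0 ap np] [q0 aq nq] pq; have [//|pqN] := eqVneq (p n) (q n).
pose w i := if (i <= n.+1)%N then p i else q (n.+1.*2 - i)%N.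
have wp i : (i <= n.+1)%N -> w i = p i by rewrite /w => ->.
have wq i : (n.+1 <= i)%N -> w i = q (n.+1.*2 - i)%N.
  move=> ni; rewrite /w; case: ifP => // iN.
  have -> : i = n.+1 by lia.
  by rewrite pq; congr q; lia.
have aw i : (i < n.+1.*2)%N -> adj (w i) (w i.+1).
  move=> iL; have [im|mi] := ltnP i n.+1; first by rewrite !wp// ltnW.
  rewrite !wq ?(leq_trans mi)// adj_sym.
  by have -> : (n.+1.*2 - i = (n.+1.*2 - i.+1).+1)%N by lia.
have nw i : (i.+1 < n.+1.*2)%N -> w i.+2 != w i.
  move=> iL; have [im|mi] := ltnP i.+1 n.+1; first by rewrite !wp//; lia.
  have [ni|in_] := ltnP n i.
    rewrite !wq//; try lia.
    have -> : (n.+1.*2 - i = (n.+1.*2 - i.+2).+2)%N by lia.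
    by rewrite eq_sym.
  have -> : i = n by lia.
  rewrite wq// wp//; have -> : (n.+1.*2 - n.+2 = n)%N by lia.
  by rewrite eq_sym.
have := nonbacktracking_inj aw nw (d := n.+1.*2.-1) (i := 0).
rewrite add0n prednK ?double_gt0// leqnn => /(_ isT).
by rewrite wq ?wp//; [rewrite subnn p0 q0 eqxx|lia].
Qed.

Lemma ray_prefix p q m n :
  ray p -> ray q -> (m <= n)%N -> p n = q n -> p m = q m.
Proof.
move=> rp rq; elim: n => [|n IH].
  by rewrite leqn0 => /eqP ->.
rewrite leq_eqVlt => /predU1P[->//|mn /(ray_parent rp rq) pq].
exact: IH.
Qed.

Lemma vertex_at_prefix xi zeta m n :
  (m <= n)%N -> xi n = zeta n -> xi m = zeta m.
Proof. exact: ray_prefix (ray_vertex_at xi) (ray_vertex_at zeta). Qed.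

Lemma walk_to_ray p n : ray p -> walk_to n (p n).
Proof.
move=> [p0 ap _]; exists [seq p k | k <- iota 1 n]; split.
- by rewrite -p0; apply: path_walk.
- rewrite -p0 last_map; case: n => // n.
  by rewrite -[n.+1]addn1 iotaD last_cat /= addnC.
- by rewrite size_map size_iota.
Qed.

(** Induction on the walk: its last vertex but one lies on some ray, at an index bounded by the
    length of the shorter walk, and by [adj_ray_level] the final edge changes the index by exactly
    one. *)
Lemma walk_to_ray_le p k m : ray p -> walk_to m (p k) -> (k <= m)%N.
Proof.
move=> rp [s [ps ls <-]]; elim/last_ind: s p k rp ps ls => [|s v IH] p k rp.
  move=> _ /= pk; have [p0 _ _] := rp; rewrite -p0 in pk.
  by rewrite -(vertex_at_level rp rp pk).
rewrite rcons_path last_rcons size_rcons => /andP[ps av] vE.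
have [q rq [j qj]] := no_leaf (last (Defs.root T) s).
have := IH _ _ rq ps (esym qj).
rewrite -qj vE in av; have := adj_ray_level rq rp av; lia.
Qed.

(** A ray is itself a walk, and by [walk_to_ray_le] no walk to its vertices is shorter. Levels are
    used below through positions on rays. *)
Lemma levelP n v : level n v <-> exists xi, xi n = v.
Proof.
split=> [[wv minv]|[xi <-]]; last first.
  split; first exact: walk_to_ray (ray_vertex_at xi).
  by move=> m; apply: walk_to_ray_le; exact: ray_vertex_at.
have [xi [k kv]] := boundary_through v; exists xi; rewrite -kv; congr (xi _).
apply/eqP; rewrite eqn_leq; apply/andP; split.
  apply: minv; rewrite -kv; apply: walk_to_ray; exact: ray_vertex_at.
by apply: (walk_to_ray_le (ray_vertex_at xi)); rewrite kv.
Qed.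

Lemma level_vertex_at xi n : level n (xi n).
Proof. by apply/levelP; exists xi. Qed.

Lemma level_vertex_at_eq xi m n : level n (xi m) -> m = n.
Proof. by move=> /levelP[zeta] /vertex_at_inj. Qed.

Lemma exists_level v : exists n, level n v.
Proof.
by have [xi [n <-]] := boundary_through v; exists n; exact: level_vertex_at.
Qed.

Lemma cylinder_level n v : level n v -> cylinder v = [set xi | xi n = v].
Proof.
move=> nv; apply/seteqP; split=> xi /=; last by exists n.
by move=> [m xv]; rewrite -xv in nv *; rewrite (level_vertex_at_eq nv).
Qed.

Lemma cylinder_vertex_at xi n : cylinder (xi n) = [set zeta | zeta n = xi n].
Proof. exact/cylinder_level/level_vertex_at. Qed.

Lemma vertex_at_neq xi zeta m n : m <> n -> xi m != zeta n.
Proof. by move=> mn; apply/eqP => /vertex_at_inj. Qed.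

(** Following [zeta] up to [n] and [xi] afterwards gives a ray that meets [xi] at [n.+1], so
    [ray_parent] applies; it cannot turn back at the junction, as vertices of distinct levels
    differ. *)
Lemma adj_level_parent xi zeta n : adj (zeta n) (xi n.+1) -> zeta n = xi n.
Proof.
move=> zx; pose w k := if (k <= n)%N then zeta k else xi k.
have wl k : (k <= n)%N -> w k = zeta k by rewrite /w => ->.
have wr k : (n < k)%N -> w k = xi k by rewrite /w ltnNge; case: leq.
have rw : ray w.
  have [z0 az nz] := ray_vertex_at zeta; have [x0 ax nx] := ray_vertex_at xi.
  split=> [|k|k]; first by rewrite wl.
    have [kn|nk] := ltnP k n; first by rewrite !wl// ltnW.
    rewrite (wr k.+1)//; move: nk; rewrite leq_eqVlt => /predU1P[<-|nk].
      by rewrite wl//; exact: zx.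
    by rewrite wr//; exact: ax.
  have [kn|nk] := ltnP k.+1 n; first by rewrite !wl//; lia.
  rewrite (wr k.+2)//; have [kn|kn] := leqP k n; last by rewrite wr.
  by rewrite wl//; apply: vertex_at_neq; lia.
by rewrite -(wl n)//; apply: (ray_parent rw (ray_vertex_at xi)); rewrite wr.
Qed.

End Levels.

(** * Topology and Borel sets of the boundary *)

Section SubbaseTopology.
Variable S : rootedGraph.

Lemma open_cylinder (v : S) : open (cylinder v).
Proof.
exists [set cylinder v]; last by rewrite bigcup_set1.
by move=> _ ->; apply: (@finI_from1 _ _ _ id); exists v.
Qed.

(** Reduction to the subbase of cylinders. It is stated for rooted graphs because the orbit tree is
    built with that type. *)
Lemma continuous_cylinder (Z : topologicalType) (f : Z -> boundary S) :
  (forall v, open (f @^-1` cylinder v)) -> continuous f.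
Proof.
move=> fv; apply/continuousP => _ [D sD <-].
rewrite preimage_bigcup; apply: bigcup_open => _ /sD[F sF <-].
rewrite preimage_bigcap bigcap_fset big_seq; elim/big_rec: _ => [|A B AF oB].
  exact: openT.
apply: openI => //; have := sF _ AF; rewrite inE => -[v _ <-]; exact: fv.
Qed.

End SubbaseTopology.

Section Topology.
Variable T : rootedTree.
Implicit Types (v w : T) (xi zeta : boundary T).

(** A finite intersection of cylinders around [xi] contains the cylinder of [xi] at the largest of
    their levels. *)
Lemma open_boundaryP (U : set (boundary T)) :
  open U <-> forall xi, U xi -> exists n, cylinder (xi n) `<=` U.
Proof.
split=> [[D sD <-] xi [A DA Axi]|UP]; last first.
  have -> : U = \bigcup_(v in [set v | cylinder v `<=` U]) cylinder v.
    apply/seteqP; split=> xi; last by move=> [v]; apply.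
    by move=> /UP[n nU]; exists (xi n) => //; exists n.
  by apply: bigcup_open => v _; exact: open_cylinder.
suff [n nA] : exists n, cylinder (xi n) `<=` A.
  by exists n => zeta /nA Az; exists A.
have [F sF FA] := sD _ DA; rewrite -{A}FA in DA Axi *.
have {}sF : forall B, B \in (F : seq _) -> exists2 v, cylinder v = B & B xi.
  move=> B BF; have := sF _ BF; rewrite inE => -[v _ vB].
  by exists v => //; exact: Axi.
suff [n nB] : exists n, forall B, B \in (F : seq _) -> cylinder (xi n) `<=` B.
  by exists n => zeta nz B /nB; exact.
elim: (F : seq _) sF => [|B s IH] sP; first by exists 0%N.
have [n nB|m mB] := IH; first by apply: sP; rewrite inE nB orbT.
have [v vB Bxi] := sP B (mem_head _ _).
have [k kv] : cylinder v xi by rewrite vB.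
exists (maxn m k) => C; rewrite inE => /predU1P[->|Cs] zeta.
  rewrite cylinder_vertex_at -vB /= => /(vertex_at_prefix (leq_maxr m k)) kz.
  by exists k; rewrite kz.
rewrite cylinder_vertex_at /= => /(vertex_at_prefix (leq_maxl m k)) mz.
by apply: mB Cs _ _; rewrite cylinder_vertex_at.
Qed.

(** Grouped by level, the union is countable once levels are finite, so open sets lie in the
    sigma-algebra generated by the cylinders. *)
Lemma open_boundaryE (U : set (boundary T)) : open U -> U =
  \bigcup_n \bigcup_(v in level n `&` [set v | cylinder v `<=` U]) cylinder v.
Proof.
move=> /open_boundaryP oU; apply/seteqP; split=> xi.
  move=> /oU[n nU]; exists n => //; exists (xi n); last by exists n.
  by split=> //; exact: level_vertex_at.
by move=> [n _ [v [_]]]; apply.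
Qed.

(** [set0] is included to make the family closed under intersection, as two cylinders may be
    disjoint. *)
Definition cylinders : set (set (boundary T)) :=
  [set A | A = set0 \/ range (@cylinder T) A].

Lemma cylindersI : setI_closed cylinders.
Proof.
move=> A B [->|[v _ <-]]; first by rewrite set0I; left.
case=> [->|[w _ <-]]; first by rewrite setI0; left.
have [[xi [[m vE] [n wE]]]|noI] := pselect (cylinder v `&` cylinder w !=set0).
  right; rewrite -vE -wE !cylinder_vertex_at.
  have [mn|/ltnW nm] := leqP m n.
    exists w => //; rewrite -wE cylinder_vertex_at setIidr// => zeta /=.
    exact: vertex_at_prefix.
  exists v => //; rewrite -vE cylinder_vertex_at setIidl// => zeta /=.
  exact: vertex_at_prefix.
by left; apply: contrapT => /eqP/set0P/noI.
Qed.

Lemma measurable_cylinder v :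
  measurable (cylinder v : set (borel (boundary T))).
Proof. by apply: sub_sigma_algebra; exact: open_cylinder. Qed.

Lemma cylinder_root : cylinder (Defs.root T) = setT.
Proof.
by apply/seteqP; split=> // xi _; exists 0%N; have [] := ray_vertex_at xi.
Qed.

Lemma measurable_boundaryE : finite_levels T ->
  @measurable _ (borel (boundary T)) = <<s cylinders >>.
Proof.
move=> fT; apply/seteqP; split.
  apply: smallest_sub; first exact: smallest_sigma_algebra.
  move=> U /open_boundaryE ->; pose M := g_sigma_algebraType cylinders.
  apply: (@bigcupT_measurable _ M) => n; apply: (@fin_bigcup_measurable _ M).
    exact/finite_setIl/fT.
  by move=> v _; apply: sub_sigma_algebra; right; exists v.
apply: smallest_sub; first exact: smallest_sigma_algebra.
move=> _ [->|[v _ <-]]; first exact: measurable0.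
exact: measurable_cylinder.
Qed.

(** The cylinders form a pi-system containing the whole space. Invariance, ergodicity and uniqueness
    of measures are reduced to cylinders through this. *)
Lemma boundary_measure_unique (R : realType)
    (m1 m2 : {measure set (borel (boundary T)) -> \bar R}) :
  finite_levels T -> (m1 setT < +oo)%E ->
  (forall v, m1 (cylinder v) = m2 (cylinder v)) ->
  forall A, measurable A -> m1 A = m2 A.
Proof.
move=> fT m1oo m12 A mA.
apply: (@measure_unique _ R (borel (boundary T)) cylinders (fun _ => setT)
  _ _ _ _ m1 m2) => //.
- exact: measurable_boundaryE.
- exact: cylindersI.
- by move=> _; right; exists (Defs.root T) => //; exact: cylinder_root.
- by apply/seteqP; split=> // xi _; exists 0%N.
- by move=> _ [->|[v _ <-]]; [rewrite !measure0|].
Qed.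

End Topology.

(** * Orbits *)

Section Orbits.
Variables (G : groupType) (T : rootedTree) (a : treeAction G T).
Implicit Types (v w : T) (xi zeta : boundary T) (eta : boundary (orbit_tree a)).

Lemma actK g v : a g^-1%g (a g v) = v.
Proof. by rewrite -actM mulVg act1. Qed.

Lemma actKV g v : a g (a g^-1%g v) = v.
Proof. by rewrite -actM mulgV act1. Qed.

Lemma psi_eqP v w : psi a v = psi a w <-> exists g, a g v = w.
Proof.
split=> [/(congr1 (@sval _ _))/= vw|[g <-]].
  have : orbit_of a w w by exact: orbit_of_self.
  by rewrite -vw => -[g _ <-]; exists g.
apply/val_inj => /=; apply/seteqP; split=> _ [h _ <-].
  by exists (h * g^-1)%g => //; rewrite actM actK.
by exists (h * g)%g => //; rewrite actM.
Qed.

Lemma orbit_ofP v w : orbit_of a v w <-> psi a w = psi a v.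
Proof.
split=> [[g _ <-]|/psi_eqP[g gw]]; first by apply/esym/psi_eqP; exists g.
by exists g^-1%g => //; rewrite -gw actK.
Qed.

Lemma psi_act g v : psi a (a g v) = psi a v.
Proof. by apply/esym/psi_eqP; exists g. Qed.

Lemma psi_surj (O : orbit_tree a) : exists v, psi a v = O.
Proof.
by have /set_mem[v _ vO] := valP O; exists v; apply/val_inj.
Qed.

Lemma level_act g n v : level n (a g v) <-> level n v.
Proof.
suff {g v} H g v : level n v -> level n (a g v).
  by split; [move=> /(H g^-1%g); rewrite actK|exact: H].
by move=> /levelP[xi <-]; apply/levelP; exists (act_boundary a g xi).
Qed.

Lemma level_psi n v w : psi a v = psi a w -> level n v -> level n w.
Proof. by move=> /psi_eqP[g <-] nv; apply/level_act. Qed.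

Lemma level_psi_vertex_at n v xi m :
  level n v -> psi a (xi m) = psi a v -> m = n.
Proof. by move=> nv /esym vx; exact/level_vertex_at_eq/(level_psi vx nv). Qed.

(** An edge between the two orbits starts at some translate of [v]; translating it back makes it
    start at [v]. *)
Lemma orbit_adj_lift v (O : orbit_tree a) :
  adj (psi a v : orbit_tree a) O -> exists2 w, adj v w & psi a w = O.
Proof.
move=> /asboolP[v' [w [[g _ <-] Ow gvw]]].
exists (a g^-1%g w); first by rewrite -(act_adj a g) actKV.
rewrite psi_act; apply/val_inj => /=.
have [u uO] := psi_surj O; rewrite -uO in Ow *.
by move: Ow => /orbit_ofP /(congr1 (@sval _ _)).
Qed.

Lemma psi_boundary_surj eta : exists xi, psi_boundary a xi = eta.
Proof.
have [e0 ae ne] : ray eta by exact: set_mem (valP eta).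
(* The condition on [v] stands inside the existential so that the choice of [w] is total; [v] itself
   is the dummy value when it fails. *)
have step n v : exists w, psi a v = eta n -> adj v w /\ psi a w = eta n.+1.
  have [ve|ve] := pselect (psi a v = eta n); last by exists v.
  have [|w vw we] := @orbit_adj_lift v (eta n.+1).
    by rewrite ve; exact: ae.
  by exists w.
pose p := fix p n :=
  if n is m.+1 then projT1 (cid (step m (p m))) else Defs.root T.
have pe n : psi a (p n) = eta n.
  by elim: n => [|n IH]; [rewrite e0|case: (projT2 (cid (step n (p n))) IH)].
have rp : ray p.
  split=> // n; first by case: (projT2 (cid (step n (p n))) (pe n)).
  by apply: contraNneq (ne n) => pn; rewrite -!pe pn.
have [xi xp] := boundary_of_ray rp; exists xi.
apply/val_inj/funext => n; rewrite -[RHS]pe /=.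
by congr psi; rewrite xp.
Qed.

Lemma subtree_psi xi v :
  subtree (psi_boundary a xi) v <-> exists n, psi a (xi n) = psi a v.
Proof. by split=> [[n _ nv]|[n nv]]; exists n. Qed.

Lemma subtree_level n xi :
  level n `&` subtree (psi_boundary a xi) = orbit_of a (xi n).
Proof.
apply/seteqP; split=> v /=.
  move=> [nv /subtree_psi[m xv]]; apply/orbit_ofP.
  by rewrite -xv (level_psi_vertex_at nv xv).
move=> /orbit_ofP vx; split.
  exact/(level_psi (esym vx))/level_vertex_at.
by apply/subtree_psi; exists n.
Qed.

(** These clopen [G]-invariant sets cut out the fibres of [psi_boundary]; they carry the passage
    between measures on the boundary and points of the orbit boundary. *)
Definition through_orbit v : set (boundary T) :=
  psi_boundary a @^-1` cylinder (psi a v : orbit_tree a).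

Lemma through_orbit_level n v : level n v ->
  through_orbit v = [set xi | psi a (xi n) = psi a v].
Proof.
move=> nv; apply/seteqP; split=> xi /=; last by exists n.
by move=> [m xv]; rewrite -xv -(level_psi_vertex_at nv xv).
Qed.

Lemma through_orbit_vertex_at xi n :
  through_orbit (xi n) = [set zeta | psi a (zeta n) = psi a (xi n)].
Proof. exact/through_orbit_level/level_vertex_at. Qed.

Lemma through_orbit_bigcup v :
  through_orbit v = \bigcup_(w in orbit_of a v) cylinder w.
Proof.
apply/seteqP; split=> xi [].
  by move=> n xv; exists (xi n); [exact/orbit_ofP|exists n].
by move=> w /orbit_ofP wv [n xw]; exists n; rewrite /= -wv -xw.
Qed.

Lemma open_through_orbit v : open (through_orbit v).
Proof.
rewrite through_orbit_bigcup; apply: bigcup_open => w _.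
exact: open_cylinder.
Qed.

Lemma closed_through_orbit v : closed (through_orbit v).
Proof.
have [n nv] := exists_level v.
rewrite -openC; apply/open_boundaryP => xi xv; exists n => zeta.
rewrite cylinder_vertex_at (through_orbit_level nv) /= => zx.
by rewrite zx; move: xv; rewrite (through_orbit_level nv).
Qed.

Lemma continuous_psi_boundary : continuous (psi_boundary a).
Proof.
apply: continuous_cylinder => O; have [v <-] := psi_surj O.
exact: open_through_orbit.
Qed.

Lemma measurable_through_orbit v :
  measurable (through_orbit v : set (borel (boundary T))).
Proof. by apply: sub_sigma_algebra; exact: open_through_orbit. Qed.

Lemma psi_boundary_fiber xi :
  [set zeta | psi_boundary a zeta = psi_boundary a xi] =
  \bigcap_n through_orbit (xi n).
Proof.
apply/seteqP; split=> zeta /= => [zx n _|zx].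
  rewrite through_orbit_vertex_at /=.
  by have := congr1 (fun e => vertex_at e n) zx.
apply/val_inj/funext => n; have := zx n I.
by rewrite through_orbit_vertex_at.
Qed.

Lemma act_boundary_cylinder g v :
  act_boundary a g @^-1` cylinder v = cylinder (a g^-1%g v).
Proof.
apply/seteqP; split=> xi [n nv]; exists n.
  by rewrite -nv actK.
by rewrite -[LHS]/(a g (xi n)) nv actKV.
Qed.

Lemma psi_boundary_act g xi :
  psi_boundary a (act_boundary a g xi) = psi_boundary a xi.
Proof. by apply/val_inj/funext => n /=; rewrite psi_act. Qed.

Lemma act_boundary_through_orbit g v :
  act_boundary a g @^-1` through_orbit v = through_orbit v.
Proof.
by apply/seteqP; split=> xi; rewrite /through_orbit /= psi_boundary_act.
Qed.

Lemma finite_orbit v : finite_levels T -> finite_set (orbit_of a v).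
Proof.
move=> fT; have [n nv] := exists_level v; apply: sub_finite_set (fT n).
by move=> w /orbit_ofP wv; exact: level_psi (esym wv) nv.
Qed.

Lemma card_orbit_gt0 v : finite_levels T ->
  (0 < #|` fset_set (orbit_of a v)|)%N.
Proof.
move=> fT; rewrite cardfs_gt0; apply/fset0Pn; exists v.
by rewrite in_fset_set ?inE; [exact: orbit_of_self|exact: finite_orbit].
Qed.

(** The orbit is finite and its vertices share a level, so their cylinders are disjoint. Arbitrary
    measures are allowed because the ergodicity proof applies this to a restriction of [mu]. *)
Lemma measure_through_orbit (R : realType)
    (mu : {measure set (borel (boundary T)) -> \bar R}) v (c : R) :
  finite_levels T ->
  (forall w, psi a w = psi a v -> mu (cylinder w) = c%:E) ->
  mu (through_orbit v) = (#|` fset_set (orbit_of a v)|%:R * c)%:E.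
Proof.
move=> fT muc; rewrite through_orbit_bigcup measure_fin_bigcup.
- rewrite (eq_fsbigr (fun=> c%:E)) => [|w]; last first.
    by rewrite inE => /orbit_ofP/muc.
  rewrite fsbig_finite/=; last exact: finite_orbit.
  by rewrite sumEFin big_const_seq count_predT iter_addr addr0 mulr_natl.
- exact: finite_orbit.
- move=> w w' /orbit_ofP wv /orbit_ofP w'v [xi [xw xw']].
  have [k kv] := exists_level v; move: xw xw'.
  rewrite (cylinder_level (level_psi (esym wv) kv)) /= => <-.
  by rewrite (cylinder_level (level_psi (esym w'v) kv)).
- by move=> w _; exact: measurable_cylinder.
Qed.

End Orbits.

(** * Uniform measures *)

(** Nested integer parts: truncating before the division by [k] loses nothing. For negative [y] both
    truncations are 0. *)
Lemma divn_truncnM (R : realType) (k : nat) (y : R) : (0 < k)%N ->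
  (Num.truncn (y * k%:R) %/ k)%N = Num.truncn y.
Proof.
move=> k0; have [y0|y0] := leP 0 y; last first.
  have tr (z : R) : z < 0 -> Num.truncn z = 0%N :> nat.
    move=> z0; apply/truncn0Pn.
    by rewrite -real_ltNge ?num_real// (lt_trans z0).
  by rewrite !tr ?div0n// pmulr_llt0// ltr0n.
have /andP[ty yt] := truncn_itv y0.
have yk0 : 0 <= y * k%:R by rewrite mulr_ge0.
apply/eqP; rewrite eqn_leq -ltnS ltn_divLR// leq_divRL//.
rewrite truncn_lt_nat// truncn_ge_nat// !natrM.
by rewrite ltr_pM2r ?ltr0n// yt ler_pM2r ?ltr0n.
Qed.

(* For x in [0, 1[ this is the integer part of x N; the reduction modulo N makes
   [digitsM] hold for every real x. *)
Definition digits (R : realType) (N : nat) (x : R) : nat :=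
  (Num.truncn (x * N%:R) %% N)%N.

(** Dropping the last digit, of radix [k]; this is what makes successive vertices of [digit_ray]
    adjacent. *)
Lemma digitsM (R : realType) (N k : nat) (x : R) : (0 < k)%N ->
  (digits (N * k) x %/ k)%N = digits N x.
Proof.
by move=> k0; rewrite /digits -modn_divl natrM mulrA divn_truncnM.
Qed.

Lemma digits_preimage (R : realType) (N i : nat) : (i < N)%N ->
  @digits R N @^-1` [set i] `&` `[0, 1[ =
    `[i%:R / N%:R, i.+1%:R / N%:R[%classic.
Proof.
move=> iN; have N0 : (0 < N%:R :> R) by rewrite ltr0n (leq_ltn_trans _ iN).
apply/seteqP; split=> x /=; rewrite !in_itv/= /digits.
  move=> [xi /andP[x0 x1]].
  have xN : (Num.truncn (x * N%:R) < N)%N.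
    have xN0 : 0 <= x * N%:R by rewrite mulr_ge0// ltW.
    by rewrite truncn_lt_nat// gtr_pMl.
  rewrite ler_pdivrMr// ltr_pdivlMr// -truncn_eq ?mulr_ge0// ?ltW//.
  by rewrite -xi modn_small.
move=> /andP[ix xi].
have x0 : 0 <= x by rewrite (le_trans _ ix)// divr_ge0.
rewrite ler_pdivrMr// in ix; rewrite ltr_pdivlMr// in xi.
have /eqP -> : Num.truncn (x * N%:R) == i.
  by rewrite truncn_eq ?ix ?xi// mulr_ge0// ltW.
rewrite modn_small// x0/=; split=> //; rewrite -(ltr_pM2r N0) mul1r.
by rewrite (lt_le_trans xi)// ler_nat.
Qed.

Lemma measurable_digits (R : realType) (N : nat) (A : set nat) :
  measurable (@digits R N @^-1` A).
Proof.
have mL c : measurable [set x : R | x * N%:R < c].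
  have := @mulrr_measurable R setT N%:R measurableT `]-oo, c[%classic.
  rewrite setTI; have -> : *%R^~ N%:R @^-1` `]-oo, c[ =
      [set x : R | x * N%:R < c].
    by apply/seteqP; split=> x /=; rewrite in_itv.
  by apply; exact: measurable_itv.
(* Split the line by the truncation [m] of [x * N%:R]. The piece for 0 has no lower bound, because
   negative numbers truncate to 0. *)
have -> : @digits R N @^-1` A = \bigcup_(m in [set m | A (m %% N)%N])
    ([set x : R | x * N%:R < m.+1%:R] `\`
     (if m is 0 then set0 else [set x : R | x * N%:R < m%:R])).
  apply/seteqP; split=> x /=.
    move=> Ax; exists (Num.truncn (x * N%:R)) => //=.
    split; first exact: truncnS_gt.
    case E : Num.truncn => [|m] /=; first by move=> [].
    by apply/negP; rewrite -truncn_le_nat E ltnn.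
  move=> [m Am /= [xm mx]]; suff -> : digits N x = (m %% N)%N by [].
  rewrite /digits; congr (_ %% _)%N; apply/eqP; rewrite eqn_leq.
  rewrite truncn_le_nat xm/=; case: m {xm Am} mx => // m /= /negP.
  by rewrite -truncn_le_nat -ltnNge.
apply: bigcup_measurable => m _; apply: measurableD => //.
by case: m.
Qed.

Section UnitLebesgue.
Variable R : realType.

Definition unit_lebesgue : set (measurableTypeR R) -> \bar R :=
  mrestr lebesgue_measure
    (measurable_itv `[0, 1[ :
      measurable (`[0, 1[%classic : set (measurableTypeR R))).

HB.instance Definition _ := Measure.on unit_lebesgue.

Let unit_lebesgue_setT : unit_lebesgue setT = 1%E.
Proof.
rewrite /unit_lebesgue /mrestr setTI lebesgue_measure_itv/= lte_fin ltr01.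
by rewrite -EFinB subr0.
Qed.

HB.instance Definition _ := Measure_isProbability.Build _ _ _ unit_lebesgue
  unit_lebesgue_setT.

End UnitLebesgue.

Section UniformOn.
Variables (R : realType) (G : groupType) (T : rootedTree) (a : treeAction G T).
Hypothesis T_finite : finite_levels T.
Implicit Types (v w : T) (xi zeta : boundary T).
Implicit Types mu : borel_probability (boundary T) R.

Lemma null_cylinder mu zeta n v :
  mu (through_orbit a (zeta n)) = 1%E -> level n v ->
  psi a v <> psi a (zeta n) -> mu (cylinder v) = 0%E.
Proof.
move=> mu1 nv vz.
have mt := measurable_through_orbit a (zeta n).
apply/eqP; rewrite eq_le measure_ge0 andbT.
have <- : mu (~` through_orbit a (zeta n)) = 0%E.
  by rewrite probability_setC// [X in (_ - X)%E]mu1 subee.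
apply: le_measure; rewrite ?inE.
- exact: measurable_cylinder.
- exact: measurableC.
- by rewrite (cylinder_level nv) through_orbit_vertex_at => xi /= ->.
Qed.

(** A mass of 1 shared equally by the cylinders of a finite orbit forces their values. The criterion
    serves both the constructed measure and invariant measures. *)
Lemma uniform_on_constant mu zeta :
  (forall v w n, psi a v = psi a (zeta n) -> psi a w = psi a v ->
    mu (cylinder w) = mu (cylinder v)) ->
  (forall n, mu (through_orbit a (zeta n)) = 1%E) ->
  uniform_on R (psi_boundary a zeta) mu.
Proof.
move=> mu_cst mu1; split=> [n v nv vz|v vz].
  have : orbit_of a (zeta n) v by rewrite -subtree_level.
  move=> /orbit_ofP {}vz; rewrite subtree_level.
  have muv : mu (cylinder v) \is a fin_num.
    by apply: fin_num_measure; exact: measurable_cylinder.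
  
  have muw w : psi a w = psi a (zeta n) ->
      mu (cylinder w) = (fine (mu (cylinder v)))%:E.
    by move=> wz; rewrite fineK//; apply: (mu_cst _ _ n vz); rewrite wz.
  have [] := etrans (esym (mu1 n)) (measure_through_orbit T_finite muw).
  move=> cE; rewrite -[LHS]fineK//; congr EFin.
  have c0 : #|` fset_set (orbit_of a (zeta n))|%:R != 0 :> R.
    by rewrite pnatr_eq0 -lt0n card_orbit_gt0.
  by apply: (mulfI c0); rewrite -cE mulfV.
have [n nv] := exists_level v.
apply: (null_cylinder (mu1 n) nv) => vn; apply: vz.
by apply/subtree_psi; exists n.
Qed.

End UniformOn.

(** * Construction of the uniform measure from mixed-radix digits *)

Section UniformMeasureExists.
Variables (R : realType) (G : groupType) (T : rootedTree) (a : treeAction G T).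
Variable zeta : boundary T.
Hypothesis T_finite : finite_levels T.
Implicit Types (v w : T) (xi : boundary T).

(** Membership in the orbit of [zeta n.+1] fixes the level of [w], so that [w] is a child of [v]
    when [v] has level [n]. *)
Definition children_in_orbit n v : set T :=
  [set w | adj v w /\ psi a w = psi a (zeta n.+1)].

Lemma finite_children_in_orbit n v : finite_set (children_in_orbit n v).
Proof.
apply: sub_finite_set (finite_orbit a (zeta n.+1) T_finite).
by move=> w [_ /orbit_ofP].
Qed.

Definition children n v : seq T := fset_set (children_in_orbit n v).

Lemma mem_children n v w :
  w \in children n v <-> adj v w /\ psi a w = psi a (zeta n.+1).
Proof.
rewrite /children in_fset_set ?inE//; exact: finite_children_in_orbit.
Qed.

Definition branching n := size (children n (zeta n)).

(** A group element taking [zeta n] to [v] maps one set of children bijectively onto the other. *)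
Lemma size_children n v :
  psi a v = psi a (zeta n) -> size (children n v) = branching n.
Proof.
move=> /esym/psi_eqP[g <-]; rewrite /branching /children.
have -> : children_in_orbit n (a g (zeta n)) =
    a g @` children_in_orbit n (zeta n).
  apply/seteqP; split=> [w [zw wz]|_ [w [zw wz] <-]]; last first.
    by split; rewrite ?act_adj ?psi_act.
  exists (a g^-1%g w); last by rewrite actKV.
  by split; [rewrite -(act_adj a g) actKV|rewrite psi_act].
rewrite fset_set_image; last exact: finite_children_in_orbit.
by rewrite card_imfset//=; exact: can_inj (actK a g).
Qed.

Lemma branching_gt0 n : (0 < branching n)%N.
Proof.
rewrite /branching; suff : zeta n.+1 \in children n (zeta n) by case: children.
by apply/mem_children; split=> //; have [_ + _] := ray_vertex_at zeta; apply.
Qed.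

Definition orbit_size n := (\prod_(i < n) branching i)%N.

Lemma orbit_sizeS n : orbit_size n.+1 = (orbit_size n * branching n)%N.
Proof. by rewrite /orbit_size big_ord_recr. Qed.

Lemma orbit_size_gt0 n : (0 < orbit_size n)%N.
Proof. by apply: prodn_gt0 => i; exact: branching_gt0. Qed.

(* A bijection from {i | i < orbit_size n} onto the orbit of [zeta n]; the
   parent of the vertex of index i has index i %/ branching. *)
Fixpoint orbit_enum n i : T :=
  if n is m.+1 then
    nth (Defs.root T) (children m (orbit_enum m (i %/ branching m)%N))
      (i %% branching m)%N
  else Defs.root T.

Lemma mem_orbit_enum n i :
    psi a (orbit_enum n (i %/ branching n)%N) = psi a (zeta n) ->
  orbit_enum n.+1 i \in children n (orbit_enum n (i %/ branching n)%N).
Proof.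
by move=> nz; rewrite /= mem_nth// size_children// ltn_pmod// branching_gt0.
Qed.

Lemma psi_orbit_enum n i : psi a (orbit_enum n i) = psi a (zeta n).
Proof.
elim: n i => [|n IH] i; first by have [-> _ _] := ray_vertex_at zeta.
by have /mem_children[] := mem_orbit_enum (IH (i %/ branching n)%N).
Qed.

Lemma adj_orbit_enum n i :
  adj (orbit_enum n (i %/ branching n)%N) (orbit_enum n.+1 i).
Proof.
have := mem_orbit_enum (psi_orbit_enum n (i %/ branching n)%N).
by move=> /mem_children[].
Qed.

Lemma orbit_enum_level n i : exists xi, xi n = orbit_enum n i.
Proof.
apply/levelP; apply: (level_psi (esym (psi_orbit_enum n i))).
exact: level_vertex_at.
Qed.

(** Equal vertices have equal parents, so by induction the quotients agree; the remainders then
    agree because the list of children has no repetition. *)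
Lemma orbit_enum_inj n i j : (i < orbit_size n)%N -> (j < orbit_size n)%N ->
  orbit_enum n i = orbit_enum n j -> i = j.
Proof.
elim: n i j => [|n IH] i j.
  by rewrite /orbit_size big_ord0 !ltnS !leqn0 => /eqP -> /eqP ->.
rewrite orbit_sizeS -!ltn_divLR ?branching_gt0// => iN jN ij.
have [xi xiE] := orbit_enum_level n.+1 i.
have parent l : orbit_enum n.+1 l = xi n.+1 ->
    orbit_enum n (l %/ branching n)%N = xi n.
  have [xl xlE] := orbit_enum_level n (l %/ branching n)%N.
  move=> lx; rewrite -xlE; apply: adj_level_parent.
  by rewrite xlE -lx; exact: adj_orbit_enum.
have pi_ := parent i (esym xiE).
have pj : orbit_enum n (j %/ branching n)%N = xi n.
  by apply: parent; rewrite -ij.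
have ijq : (i %/ branching n = j %/ branching n)%N.
  by apply: IH => //; rewrite pi_.
rewrite (divn_eq i (branching n)) (divn_eq j (branching n)) ijq.
congr (_ + _)%N; move: ij; rewrite /= ijq pj => /eqP.
have xz : psi a (xi n) = psi a (zeta n) by rewrite -pi_; exact: psi_orbit_enum.
rewrite nth_uniq ?size_children ?ltn_pmod ?branching_gt0// ?fset_uniq//.
by move=> /eqP.
Qed.

Lemma orbit_enum_surj n v : psi a v = psi a (zeta n) ->
  exists2 i, (i < orbit_size n)%N & orbit_enum n i = v.
Proof.
elim: n v => [|n IH] v.
  have [z0 _ _] := ray_vertex_at zeta; rewrite z0 => /esym/psi_eqP[g].
  rewrite act_root => <-; exists 0%N => //.
  by rewrite /orbit_size big_ord0.
move=> /esym/psi_eqP[g gv].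
(* The parent of [v] is the translate of [zeta n] by the same [g]; its index, followed by the
   position of [v] among the children as last digit, is the index of [v]. *)
have [|i iN iE] := IH (a g (zeta n)); first by rewrite psi_act.
have : v \in children n (a g (zeta n)).
  apply/mem_children; rewrite -gv act_adj psi_act; split=> //.
  by have [_ + _] := ray_vertex_at zeta; apply.
move=> vc; have := vc; rewrite -index_mem size_children ?psi_act// => kv.
exists (i * branching n + index v (children n (a g (zeta n))))%N.
  rewrite orbit_sizeS -ltn_divLR ?branching_gt0//.
  by rewrite divnMDl ?branching_gt0// divn_small// addn0.
rewrite /= divnMDl ?branching_gt0// divn_small// addn0 iE.
by rewrite modnMDl modn_small// nth_index.
Qed.

Lemma ray_digits (x : R) :
  ray (fun n => orbit_enum n (digits (orbit_size n) x)).
Proof.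
split=> // n; last first.
  have [xi <-] := orbit_enum_level n.+2 (digits (orbit_size n.+2) x).
  have [xi' <-] := orbit_enum_level n (digits (orbit_size n) x).
  by apply: vertex_at_neq; lia.
have := adj_orbit_enum n (digits (orbit_size n.+1) x).
by rewrite {1}orbit_sizeS digitsM ?branching_gt0.
Qed.

Definition digit_ray (x : R) : boundary T :=
  exist _ (fun n => orbit_enum n (digits (orbit_size n) x))
    (mem_set (ray_digits x)).

Lemma measurable_digit_ray :
  measurable_fun setT (digit_ray : measurableTypeR R -> borel (boundary T)).
Proof.
apply: (@measurability _ _ (measurableTypeR R) (borel (boundary T)) setT
  digit_ray (@cylinders T)); first exact: measurable_boundaryE.
move=> _ [_ [->|[v _ <-]] <-]; first by rewrite preimage_set0 setI0.
have [n nv] := exists_level v; rewrite setTI (cylinder_level nv).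
exact: (@measurable_digits R (orbit_size n) [set i | orbit_enum n i = v]).
Qed.

Lemma psi_boundary_digit_ray (x : R) n :
  psi a (digit_ray x n) = psi a (zeta n).
Proof. exact: psi_orbit_enum. Qed.

(** On [[0, 1[] the ray of [x] passes through [v] exactly when [digits] returns the index of [v],
    that is, on one interval of length [1 / orbit_size n]. *)
Lemma lebesgue_digit_ray n v : psi a v = psi a (zeta n) ->
  unit_lebesgue (digit_ray @^-1` cylinder v) = ((orbit_size n)%:R^-1)%:E.
Proof.
move=> vz; have nv : level n v := level_psi (esym vz) (level_vertex_at zeta n).
have [i iN iE] := orbit_enum_surj vz.
rewrite /unit_lebesgue /mrestr.
have -> : digit_ray @^-1` cylinder v `&` `[0, 1[ =
    `[i%:R / (orbit_size n)%:R, i.+1%:R / (orbit_size n)%:R[%classic.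
  rewrite -digits_preimage//; congr (_ `&` _).
  rewrite (cylinder_level nv) -iE; apply/seteqP; split=> x.
    by apply: orbit_enum_inj => //; rewrite ltn_pmod// orbit_size_gt0.
  by move=> xi; rewrite /= -[in RHS]xi.
have N0 : 0 < (orbit_size n)%:R :> R by rewrite ltr0n orbit_size_gt0.
rewrite lebesgue_measure_itv/= lte_fin ltr_pM2r ?invr_gt0// ltr_nat ltnSn.
by rewrite -EFinB -mulrBl -natrB// subSnn mul1r.
Qed.

Lemma uniform_measure_exists : exists mu, uniform_on R (psi_boundary a zeta) mu.
Proof.
pose mX := isMeasurableFun.Build _ _ _ _ _ measurable_digit_ray.
pose X : {mfun measurableTypeR R >-> borel (boundary T)} :=
  HB.pack (digit_ray : measurableTypeR R -> borel (boundary T)) mX.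
have [nu [nuE _]] :=
  borel_probability_unique (distribution (@unit_lebesgue R) X).
exists nu; apply: uniform_on_constant => // [v w n nv wv|n].
  rewrite !nuE; [|exact: measurable_cylinder..].
  by rewrite [LHS](@lebesgue_digit_ray n) ?wv// [RHS](@lebesgue_digit_ray n).
rewrite nuE; last exact: measurable_through_orbit.
rewrite -(probability_setT (@unit_lebesgue R)) through_orbit_vertex_at.
congr (unit_lebesgue _); apply/seteqP; split=> // x _.
exact: psi_boundary_digit_ray.
Qed.

End UniformMeasureExists.

(** * Invariant and ergodic measures *)

Lemma probability_bigcap d (S : measurableType d) (R : realType)
    (P : probability S R) (F : (set S)^nat) :
  (forall n, measurable (F n)) -> (forall n, P (F n) = 1%E) ->
  P (\bigcap_n F n) = 1%E.
Proof.
move=> mF F1; have mI : measurable (\bigcap_n F n) by exact: bigcapT_measurable.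
suff : P (~` \bigcap_n F n) = 0%E.
  move=> I0; rewrite -[X in P X]setCK probability_setC ?I0 ?sube0//.
  exact: measurableC.
rewrite setC_bigcap; apply: measure_negligible.
  by apply: bigcup_measurable => n _; exact: measurableC.
apply: negligible_bigcup => n; apply/negligibleP; first exact: measurableC.
by rewrite [LHS](probability_setC P (mF n)) F1 subee.
Qed.

Section InvariantMeasureTheory.
Variables (R : realType) (G : groupType) (T : rootedTree) (a : treeAction G T).
Hypothesis T_finite : finite_levels T.
Implicit Types (v w : T) (xi zeta : boundary T) (eta : boundary (orbit_tree a)).
Implicit Types mu nu : borel_probability (boundary T) R.

Lemma borel_probability_ext mu nu :
  (forall A, measurable A -> mu A = nu A) -> mu = nu.
Proof.
move=> mn; apply/val_inj/eq_prob/funext => A.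
have [/mn//|nA] := pselect (measurable A).
by rewrite (set_mem (valP mu)) ?(set_mem (valP nu)).
Qed.

Lemma borel_probability_cylinder_ext mu nu :
  (forall v, mu (cylinder v) = nu (cylinder v)) -> mu = nu.
Proof.
move=> mn; apply: borel_probability_ext.
apply: boundary_measure_unique => //; rewrite [X in (X < _)%E]probability_setT.
exact: ltry.
Qed.

Lemma uniform_on_through_orbit mu zeta n :
  uniform_on R (psi_boundary a zeta) mu -> mu (through_orbit a (zeta n)) = 1%E.
Proof.
move=> [mu_lev _]; set N := #|` fset_set (orbit_of a (zeta n))|.
rewrite [LHS](measure_through_orbit (c := N%:R^-1)) -/N//.
  by rewrite mulfV// pnatr_eq0 -lt0n card_orbit_gt0.
move=> w wz; have nw : orbit_of a (zeta n) w by exact/orbit_ofP.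
move: nw; rewrite -subtree_level => -[nw zw].
by rewrite [LHS](mu_lev n)// subtree_level.
Qed.

Lemma uniform_on_unique mu nu eta :
  uniform_on R eta mu -> uniform_on R eta nu -> mu = nu.
Proof.
move=> [mu1 mu0] [nu1 nu0]; apply: borel_probability_cylinder_ext => v.
have [n nv] := exists_level v.
have [ve|ve] := pselect (subtree eta v); last by rewrite mu0// nu0.
by rewrite (mu1 n)// (nu1 n).
Qed.

Lemma uniform_measureP eta : uniform_on R eta (uniform_measure R eta).
Proof.
have [zeta <-] := psi_boundary_surj eta.
by have [mu muE] := uniform_measure_exists R a zeta T_finite; apply: getI muE.
Qed.

Lemma uniform_measure_unique mu eta :
  uniform_on R eta mu -> mu = uniform_measure R eta.
Proof. by move=> mue; apply: uniform_on_unique mue (uniform_measureP eta). Qed.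

Lemma invariant_cylinder mu v w : invariant_measures R a mu ->
  psi a v = psi a w -> mu (cylinder v) = mu (cylinder w).
Proof.
move=> muG /esym/psi_eqP[g <-]; rewrite -(muG g (cylinder (a g w))).
  by rewrite act_boundary_cylinder actK.
exact: measurable_cylinder.
Qed.

Lemma invariant_uniform_measure mu zeta : invariant_measures R a mu ->
  (forall n, mu (through_orbit a (zeta n)) = 1%E) ->
  mu = uniform_measure R (psi_boundary a zeta).
Proof.
move=> muG mu1; apply/uniform_measure_unique/uniform_on_constant => //.
by move=> v w _ _ wv; exact: invariant_cylinder.
Qed.

Lemma measurable_act_boundary g : measurable_fun setT
  (act_boundary a g : borel (boundary T) -> borel (boundary T)).
Proof.
apply: (@measurability _ _ (borel (boundary T)) (borel (boundary T)) setT
  (act_boundary a g) (@cylinders T)); first exact: measurable_boundaryE.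
move=> _ [_ [->|[v _ <-]] <-]; first by rewrite preimage_set0 setI0.
by rewrite setTI act_boundary_cylinder; exact: measurable_cylinder.
Qed.

Lemma uniform_measure_invariant eta :
  invariant_measures R a (uniform_measure R eta).
Proof.
move=> g; have [mu1 mu0] := uniform_measureP eta.
set mu := uniform_measure R eta.
pose mX := isMeasurableFun.Build _ _ _ _ _ (measurable_act_boundary g).
pose X : {mfun borel (boundary T) >-> borel (boundary T)} := HB.pack
  (act_boundary a g : borel (boundary T) -> borel (boundary T)) mX.
apply: (@boundary_measure_unique T R (distribution mu X) mu) => // [|v].
  by rewrite [X in (X < _)%E]probability_setT; exact: ltry.
rewrite -[LHS]/(mu (act_boundary a g @^-1` cylinder v)) act_boundary_cylinder.
have psig : subtree eta (a g^-1%g v) = subtree eta v.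
  by rewrite /subtree /preimage /= psi_act.
have [n nv] := exists_level v.
have [ve|ve] := pselect (subtree eta v); last first.
  by rewrite [LHS]mu0 ?psig// [RHS]mu0.
have nv' : level n (a g^-1%g v) by exact/level_act.
by rewrite [LHS](mu1 n) ?psig// [RHS](mu1 n).
Qed.

Lemma uniform_measure_ergodic eta :
  ergodic_measures R a (uniform_measure R eta).
Proof.
split=> [|A mA AG]; first exact: uniform_measure_invariant.
have [zeta zE] := psi_boundary_surj eta.
have mue := uniform_measureP eta; have muG := uniform_measure_invariant eta.
set mu := uniform_measure R eta in mue muG *; rewrite -zE in mue.
have mu1 n := uniform_on_through_orbit n mue.
have muA : mu A \is a fin_num by exact: fin_num_measure.
pose r := NngNum (fine_ge0 (measure_ge0 mu A)).
(* Restricting [mu] to [A] and scaling it by [mu A] give the same measure, since they agree on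
   cylinders. At [A] this says that [mu A] equals its square. *)
have muAA : mrestr mu mA A = mscale r mu A.
  apply: (@boundary_measure_unique T R (mrestr mu mA) (mscale r mu)) => //.
    by rewrite -[X in (X < _)%E]/(mu (setT `&` A)) setTI ltey_eq muA.
  move=> v; rewrite -[LHS]/(mu (cylinder v `&` A)).
  rewrite -[RHS]/((fine (mu A))%:E * mu (cylinder v))%E fineK//.
  have [n nv] := exists_level v.
  have [vz|vz] := pselect (psi a v = psi a (zeta n)); last first.
    have v0 := null_cylinder (mu1 n) nv vz.
    rewrite [X in (_ * X)%E]v0 mule0.
    apply/eqP; rewrite eq_le measure_ge0 andbT.
    rewrite -[leRHS]v0; apply: le_measure; rewrite ?inE//.
      by apply: measurableI => //; exact: measurable_cylinder.
    exact: measurable_cylinder.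
  (* As [A] is invariant, [cylinder w] and [cylinder v] meet [A] in translates of each other. *)
  have vAE w : psi a w = psi a (zeta n) ->
      mu (cylinder w `&` A) = (fine (mu (cylinder v `&` A)))%:E.
    move=> wz.
    have mvA : measurable (cylinder v `&` A : set (borel (boundary T))).
      by apply: measurableI => //; exact: measurable_cylinder.
    rewrite fineK ?fin_num_measure//.
    have /psi_eqP[g gv] : psi a w = psi a v by rewrite wz.
    rewrite -(muG g _ mvA) preimage_setI AG act_boundary_cylinder -gv.
    by rewrite actK.
  have vE w : psi a w = psi a (zeta n) ->
      mu (cylinder w) = (fine (mu (cylinder v)))%:E.
    move=> wz; rewrite fineK; last first.
      by apply: fin_num_measure; exact: measurable_cylinder.
    by apply: invariant_cylinder => //; rewrite wz.
  have := measure_through_orbit (mu := mrestr mu mA) T_finite vAE.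
  have := measure_through_orbit (mu := mu) T_finite vE.
  set N := #|` _|; rewrite [X in X = _ -> _]mu1 => -[N1] muAN.
  have thruA : mu (through_orbit a (zeta n) `&` A) = mu A.
    have mt := measurable_through_orbit a (zeta n).
    apply/esym; rewrite [LHS](measureDI _ mA mt) setIC -[RHS]add0e.
    congr (_ + _)%E.
    apply: (@subset_measure0 _ _ _ mu _ (~` through_orbit a (zeta n))).
    - exact: measurableD.
    - exact: measurableC.
    - by move=> ? [].
    - by rewrite [LHS](probability_setC mu mt) [X in (_ - X)%E]mu1 subee.
  have {thruA}muAN := etrans (esym thruA) muAN.
  (* Summed over the orbit, [N] times the mass of [cylinder v] within [A] is [mu A], while [N] times
     the mass of [cylinder v] is 1; eliminate [N]. *)
  rewrite [LHS]vAE// [X in (_ * X)%E]vE// muAN -EFinM.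
  by congr EFin; rewrite mulrC mulrA [X in X * _]mulrC -N1 mul1r.
have [A0|A1] : fine (mu A) = 0 \/ fine (mu A) = 1.
  move: muAA; rewrite /mrestr setIid /mscale/= -(fineK muA) -EFinM.
  move=> [] /esym/eqP.
  by rewrite -subr_eq0 -{3}[fine _]mulr1 -mulrBr mulf_eq0 subr_eq0
    => /orP[/eqP|/eqP]; [left|right].
- by left; rewrite -(fineK muA) A0.
- by right; rewrite -(fineK muA) A1.
Qed.

(** Each orbit set is invariant, so it has mass 0 or 1. If none had mass 1, all cylinders of level
    [n] would be null, yet finitely many of them cover the space. *)
Lemma ergodic_through_orbit mu n : ergodic_measures R a mu ->
  exists v, level n v /\ mu (through_orbit a v) = 1%E.
Proof.
move=> [muG mu01]; apply: contrapT => no1.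
have mu0 v : level n v -> mu (cylinder v) = 0%E.
  move=> nv; have mt := measurable_through_orbit a v.
  have [|t0|t1] := mu01 _ mt.
  - by move=> g; exact: act_boundary_through_orbit.
  - apply: (@subset_measure0 _ _ _ mu _ (through_orbit a v)) => //.
      exact: measurable_cylinder.
    rewrite through_orbit_bigcup => xi vxi.
    by exists v => //; exact: orbit_of_self.
  - by exfalso; apply: no1; exists v.
have : mu setT = 0%E.
  have -> : [set: boundary T] = \bigcup_(v in level n) cylinder v.
    apply/seteqP; split=> // xi _; exists (xi n); last by exists n.
    exact: level_vertex_at.
  rewrite measure_fin_bigcup => [||v w nv nw [xi []]|v _].
  - by rewrite fsbig1.
  - exact: T_finite.
  - by rewrite (cylinder_level nv) (cylinder_level nw) /= => <-.
  - exact: measurable_cylinder.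
by move=> /eqP; rewrite [X in X == _]probability_setT onee_eq0.
Qed.

Lemma ergodic_uniform_measure mu : ergodic_measures R a mu ->
  exists zeta, mu = uniform_measure R (psi_boundary a zeta).
Proof.
move=> muE; have [v_ v_P] := choice (fun n => ergodic_through_orbit n muE).
have mt n := measurable_through_orbit a (v_ n).
(* A countable intersection of sets of mass 1 has mass 1, hence is not empty; any of its points
   serves as [zeta]. *)
have [zeta zI] : \bigcap_n through_orbit a (v_ n) !=set0.
  apply/set0P/eqP => I0.
  have := probability_bigcap mt (fun n => (v_P n).2).
  by rewrite I0 measure0 => /eqP; rewrite eq_sym onee_eq0.
exists zeta; apply: invariant_uniform_measure; first by case: muE.
move=> n; have [nv v1] := v_P n; have := zI n I.
rewrite (through_orbit_level a nv) /= => zv.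
by rewrite -v1 (through_orbit_level a nv) through_orbit_vertex_at zv.
Qed.

(** The measure remembers its subtree; its support and the injectivity of [uniform_measure] are read
    off from this. *)
Lemma uniform_measure_cylinder_gt0 eta v :
  subtree eta v <-> (0 < uniform_measure R eta (cylinder v))%E.
Proof.
have [mu1 mu0] := uniform_measureP eta.
split=> [ve|]; last by apply: contraPP => /mu0 ->; rewrite ltxx.
have [n nv] := exists_level v; rewrite (mu1 n)// lte_fin invr_gt0 ltr0n.
have [zeta zE] := psi_boundary_surj eta.
by rewrite -zE subtree_level card_orbit_gt0.
Qed.

Lemma uniform_measure_support eta :
  measure_support (uniform_measure R eta) = subtree_boundary eta.
Proof.
apply/seteqP; split; rewrite /measure_support /subtree_boundary.
  move=> /= xi xs n; apply/uniform_measure_cylinder_gt0/xs.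
  by split; [exact: open_cylinder|exists n].
move=> /= xi xs U [/[dup] oU /open_boundaryP UP /UP[n nU]].
have /uniform_measure_cylinder_gt0 := xs n.
move=> /lt_le_trans; apply; apply: le_measure => //; rewrite inE.
  exact: measurable_cylinder.
exact: sub_sigma_algebra.
Qed.

Lemma uniform_measure_fiber zeta :
  uniform_measure R (psi_boundary a zeta)
    [set xi | psi_boundary a xi = psi_boundary a zeta] = 1%E.
Proof.
rewrite psi_boundary_fiber; apply: probability_bigcap => n.
  exact: measurable_through_orbit.
exact: uniform_on_through_orbit (uniform_measureP _).
Qed.

Lemma uniform_measure_inj : injective (@uniform_measure R G T a).
Proof.
move=> eta eta'; have [zeta <-] := psi_boundary_surj eta.
have [xi <-] := psi_boundary_surj eta' => zxE.
apply/val_inj/funext => n.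
have : subtree (psi_boundary a xi) (xi n) by apply/subtree_psi; exists n.
move=> /uniform_measure_cylinder_gt0; rewrite -zxE.
move=> /uniform_measure_cylinder_gt0/subtree_psi[m zm].
by rewrite -[RHS]zm (level_psi_vertex_at (level_vertex_at xi n) zm).
Qed.

End InvariantMeasureTheory.

(** * Weak continuity *)

Lemma measurable_continuous (R : realType) (X : ptopologicalType) (f : X -> R) :
  continuous f -> measurable_fun setT (f : borel X -> R).
Proof.
move=> /continuousP cf; apply: (measurability _ (RGenOpens.measurableE R)).
move=> _ [_ [a [b ->] <-]]; rewrite setTI; apply: sub_sigma_algebra.
exact/cf/interval_open.
Qed.


Section UniformContinuity.
Variables (R : realType) (T : rootedTree).
Hypothesis T_finite : finite_levels T.
Implicit Types (v w : T) (xi zeta : boundary T).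

(* If no level works, then Koenig's lemma yields a ray each of whose vertices
   has the same defect; continuity fails at that ray. *)
Lemma boundary_unif_continuous (f : boundary T -> R) (e : R) :
  continuous f -> 0 < e ->
  exists n, forall xi zeta, xi n = zeta n -> `|f xi - f zeta| < e.
Proof.
move=> cf e0.
pose good v n := forall xi zeta, cylinder v xi -> xi n = zeta n ->
  `|f xi - f zeta| < e.
have [[n rn]|bad_root] := pselect (exists n, good (Defs.root T) n).
  by exists n => xi zeta; apply: rn; rewrite cylinder_root.
pose bad v := ~ exists n, good v n.
have step xi n : exists zeta, bad (xi n) -> zeta n = xi n /\ bad (zeta n.+1).
  have [bx|] := pselect (bad (xi n)); last by exists xi.
  apply: contrapT => nozeta.
  have goodE w : exists N, cylinder (xi n) `&` cylinder w !=set0 ->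
      level n.+1 w -> good w N.
    have [[zeta [xz zw]]|] := pselect (cylinder (xi n) `&` cylinder w !=set0).
      have [nw|] := pselect (level n.+1 w); last by exists 0%N.
      apply: contrapT => noN; apply: nozeta; exists zeta => _.
      move: xz zw; rewrite cylinder_vertex_at (cylinder_level nw) /= => xz zw.
      split=> // -[N gN]; apply: noN; exists N => _ _; rewrite -zw; exact: gN.
    by exists 0%N.
  have [N NP] := choice goodE.
  (* Level [n.+1] is finite, so one depth serves all its vertices below [xi n], and thus [xi n]
     itself. *)
  apply: bx; exists (maxn n.+1 (\max_(w <- fset_set (level n.+1)) N w)).
  move=> zeta zeta' xz zz'.
  have nz := level_vertex_at zeta n.+1.
  have cz : cylinder (zeta n.+1) zeta by exists n.+1.
  have xzz : cylinder (xi n) `&` cylinder (zeta n.+1) !=set0 by exists zeta.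
  apply: (NP _ xzz nz _ _ cz).
  apply: vertex_at_prefix zz'; rewrite leq_max; apply/orP; right.
  apply: leq_bigmax_seq => //; rewrite in_fset_set; last exact: T_finite.
  exact/mem_set.
have [xi0 _] := boundary_nonempty T.
(* Each chosen ray agrees with the next up to the current level, so the diagonal [x n n] is again a
   ray, and all its vertices are bad. *)
pose x := fix x n := if n is m.+1 then projT1 (cid (step (x m) m)) else xi0.
have xbad n : bad (x n n).
  elim: n => [|n IH]; last by case: (projT2 (cid (step (x n) n)) IH).
  by have [-> _ _] := ray_vertex_at xi0.
have xS n : x n.+1 n = x n n by case: (projT2 (cid (step (x n) n)) (xbad n)).
have xn k n : (k <= n)%N -> x n k = x k k.
  elim: n => [|n IH]; first by rewrite leqn0 => /eqP ->.
  rewrite leq_eqVlt => /predU1P[->//|kn].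
  by rewrite -(IH kn); apply: vertex_at_prefix (xS n).
have rx : ray (fun n => x n n).
  split=> [|n|n]; first by have [] := ray_vertex_at xi0.
    by rewrite -(xn n n.+1)//; have [_ + _] := ray_vertex_at (x n.+1); apply.
  by apply: vertex_at_neq; lia.
have [xi xiE] := boundary_of_ray rx.
have e20 : 0 < e / 2 by exact: divr_gt0.
have oB : open (f @^-1` ball (f xi) (e / 2)).
  by have /continuousP := cf; apply; exact: ball_open.
have [|n xn2] := (open_boundaryP _).1 oB xi; first exact: ballxx.
exfalso; apply: (xbad n); exists n => zeta zeta' zx zz'.
have xiEn : xi n = x n n by rewrite xiE.
have := xn2 zeta; rewrite xiEn => /(_ zx); rewrite /ball/= => fz.
have zx' : cylinder (x n n) zeta'.
  by move: zx; rewrite cylinder_vertex_at /= -zz'.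
have := xn2 zeta'; rewrite xiEn => /(_ zx'); rewrite /ball/= => fz'.
rewrite (splitr e) (le_lt_trans (ler_distD (f xi) _ _))//.
by rewrite ltrD// distrC.
Qed.


End UniformContinuity.

(** * Approximation of integrals by step functions on one level *)

Section LevelRetraction.
Variables (R : realType) (T : rootedTree).
Hypothesis T_finite : finite_levels T.
Implicit Types (v w : T) (xi zeta : boundary T).

Lemma vertex_preimage_bigcup n (B : set T) :
  [set xi : boundary T | B (xi n)] =
  \bigcup_(v in level n `&` B) cylinder v.
Proof.
apply/seteqP; split=> xi /=; last first.
  by move=> [v [nv Bv]]; rewrite (cylinder_level nv) /= => ->.
by move=> Bx; exists (xi n); [split=> //; exact: level_vertex_at|exists n].
Qed.

Lemma finite_level_setI n (B : set T) : finite_set (level n `&` B).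
Proof. exact/finite_setIl/T_finite. Qed.

Lemma measurable_vertex_preimage n (B : set T) :
  measurable ([set xi : boundary T | B (xi n)] : set (borel (boundary T))).
Proof.
rewrite vertex_preimage_bigcup; apply: fin_bigcup_measurable.
  exact: finite_level_setI.
by move=> v _; exact: measurable_cylinder.
Qed.

Lemma eq_measure_vertex_preimage
    (m1 m2 : {measure set (borel (boundary T)) -> \bar R}) n (B : set T) :
  (forall v, level n v -> m1 (cylinder v) = m2 (cylinder v)) ->
  m1 [set xi : boundary T | B (xi n)] = m2 [set xi : boundary T | B (xi n)].
Proof.
move=> m12; rewrite vertex_preimage_bigcup.
have triv : trivIset (level n `&` B) (@cylinder T).
  move=> v w [nv _] [nw _] [xi []].
  by rewrite (cylinder_level nv) (cylinder_level nw) /= => <-.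
have fin := finite_level_setI n B.
rewrite !measure_fin_bigcup//; try by move=> v _; exact: measurable_cylinder.
by apply: eq_fsbigr => v /set_mem[nv _]; exact: m12.
Qed.

Definition ray_through v : boundary T := projT1 (cid (boundary_through v)).

(* [f \o level_retraction n] is the step function on level n cylinders that
   approximates f. *)
Definition level_retraction n xi : boundary T := ray_through (xi n).

Lemma level_retraction_vertex_at n xi : level_retraction n xi n = xi n.
Proof.
rewrite /level_retraction /ray_through; case: cid => zeta [k kx] /=.
by rewrite -kx (vertex_at_inj kx).
Qed.

(** Whatever the set, its preimage depends on the level [n] vertex alone and is a finite union of
    cylinders. *)
Lemma measurable_level_retraction n : measurable_fun setT
  (level_retraction n : borel (boundary T) -> borel (boundary T)).
Proof.
move=> _ A mA; rewrite setTI.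
exact: (measurable_vertex_preimage n [set v | A (ray_through v)]).
Qed.

Section Integral.
Variable f : boundary T -> R.
Hypothesis f_continuous : continuous f.
Hypothesis f_bounded : [bounded f x | x in [set: boundary T]].
Variable n : nat.

Let f_retraction_bounded :
  [bounded (f \o level_retraction n) x | x in [set: boundary T]].
Proof.
by move: f_bounded => [M [Mr fM]]; exists M; split=> // x /fM + y _; apply.
Qed.

Let measurable_f : measurable_fun setT (f : borel (boundary T) -> R).
Proof. exact: measurable_continuous. Qed.

Let measurable_f_retraction :
  measurable_fun setT (f \o level_retraction n : borel (boundary T) -> R).
Proof.
by apply: measurableT_comp measurable_f (measurable_level_retraction n).
Qed.

Let integrable_bounded (mu : probability (borel (boundary T)) R)
    (g : borel (boundary T) -> R) : measurable_fun setT g ->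
  [bounded g x | x in [set: boundary T]] -> mu.-integrable setT (EFin \o g).
Proof.
move=> mg bg; apply: measurable_bounded_integrable => //.
by rewrite [X in (X < _)%E]probability_setT ltry.
Qed.

Lemma Rintegral_retraction_dist (mu : probability (borel (boundary T)) R) e :
  (forall xi zeta, xi n = zeta n -> `|f xi - f zeta| < e) ->
  `|\int[mu]_x f x - \int[mu]_x (f \o level_retraction n) x| <= e.
Proof.
move=> fe; have fi := integrable_bounded mu measurable_f f_bounded.
have fri := integrable_bounded mu measurable_f_retraction f_retraction_bounded.
have fdi : mu.-integrable setT
    (EFin \o (fun x => f x - (f \o level_retraction n) x)).
  by have := integrableB measurableT fi fri; exact.
rewrite -RintegralB//; apply: (le_trans (le_normr_Rintegral _ _)) => //.
have -> : e = \int[mu]_(x in [set: borel (boundary T)]) e.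
  by rewrite Rintegral_cst// [X in fine X]probability_setT mulr1.
apply: le_Rintegral => // [||x _].
- exact: integrable_norm.
- exact: finite_measure_integrable_cst.
- by apply/ltW/fe; rewrite level_retraction_vertex_at.
Qed.

(** The retraction sends both measures to the same image, because preimages under it are finite
    disjoint unions of level [n] cylinders. *)
Lemma eq_Rintegral_retraction (m1 m2 : probability (borel (boundary T)) R) :
  (forall v, level n v -> m1 (cylinder v) = m2 (cylinder v)) ->
  \int[m1]_x (f \o level_retraction n) x =
  \int[m2]_x (f \o level_retraction n) x.
Proof.
move=> m12.
pose mX := isMeasurableFun.Build _ _ _ _ _ (measurable_level_retraction n).
pose X : {mfun borel (boundary T) >-> borel (boundary T)} := HB.pack
  (level_retraction n : borel (boundary T) -> borel (boundary T)) mX.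
have E (m : probability (borel (boundary T)) R) :
    \int[m]_x (f \o level_retraction n) x = \int[distribution m X]_x f x.
  rewrite /Rintegral integral_distribution//; first exact/measurable_EFinP.
  exact: integrable_bounded.
rewrite !E; congr fine; apply: eq_measure_integral => A _ _.
exact: (eq_measure_vertex_preimage [set v | A (ray_through v)] m12).
Qed.

(** Each measure costs one [e] for replacing [f] by its step function, whose two integrals agree. *)
Lemma Rintegral_dist (m1 m2 : probability (borel (boundary T)) R) e :
  (forall xi zeta, xi n = zeta n -> `|f xi - f zeta| < e) ->
  (forall v, level n v -> m1 (cylinder v) = m2 (cylinder v)) ->
  `|\int[m1]_x f x - \int[m2]_x f x| <= e + e.
Proof.
move=> fe m12; set r1 := \int[m1]_x (f \o level_retraction n) x.
apply: (le_trans (ler_distD r1 _ _)); apply: lerD.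
  exact: Rintegral_retraction_dist.
rewrite /r1 (eq_Rintegral_retraction m12) distrC.
exact: Rintegral_retraction_dist.
Qed.

End Integral.
End LevelRetraction.

(** * Ergodic decomposition *)

(** The weak topology is initial for [integrals], a map into such a product; continuity is thereby
    tested on one function at a time. *)
Lemma continuous_prod_topology (I : Type) (K : I -> topologicalType)
    (Z : topologicalType) (F : Z -> prod_topology K) :
  (forall i, continuous (fun z => F z i)) -> continuous F.
Proof.
move=> cF z; apply/cvg_sup => i; move: z.
apply: (@continuous_comp_initial _ _ _ (@proj I K i) F).
exact: cF.
Qed.

Section ErgodicDecomposition.
Variables (R : realType) (G : groupType) (T : rootedTree) (a : treeAction G T).
Hypothesis T_finite : finite_levels T.
Implicit Types (v w : T) (xi zeta : boundary T) (eta : boundary (orbit_tree a)).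
Implicit Types mu nu : borel_probability (boundary T) R.

(** As a function of [zeta] this is a constant times the indicator of a clopen set, which is the
    form needed for continuity, measurability and integration. *)
Lemma uniform_measure_cylinder v zeta :
  uniform_measure R (psi_boundary a zeta) (cylinder v) =
  ((#|` fset_set (orbit_of a v)|%:R)^-1 *
    \1_(through_orbit a v) zeta)%:E.
Proof.
have [n nv] := exists_level v.
have [mu1 mu0] := uniform_measureP R T_finite (psi_boundary a zeta).
have [zv|zv] := pselect (psi a (zeta n) = psi a v).
  have vs : (level n `&` subtree (psi_boundary a zeta)) v.
    by rewrite subtree_level; apply/orbit_ofP.
  rewrite (mu1 n) ?indicE ?mem_set ?mulr1//; last 2 first.
  - by rewrite (through_orbit_level a nv).
  - by case: vs.
  rewrite subtree_level; congr ((_ %:R)^-1)%:E; congr (size (fset_set _)).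
  by have := congr1 (@sval _ _) zv.
rewrite mu0 ?indicE ?memNset ?mulr0//.
  by rewrite (through_orbit_level a nv).
by move=> /subtree_psi[m zm]; apply: zv; rewrite -(level_psi_vertex_at nv zm).
Qed.

Lemma uniform_measure_through_orbit v zeta :
  uniform_measure R (psi_boundary a zeta) (through_orbit a v) =
  (\1_(through_orbit a v) zeta)%:E.
Proof.
rewrite [LHS](measure_through_orbit T_finite (c :=
  (#|` fset_set (orbit_of a v)|%:R)^-1 * \1_(through_orbit a v) zeta)).
  by rewrite mulrA mulfV ?mul1r// pnatr_eq0 -lt0n card_orbit_gt0.
move=> w wv; rewrite [LHS]uniform_measure_cylinder.
have -> : orbit_of a w = orbit_of a v by have := congr1 (@sval _ _) wv.
by rewrite /through_orbit wv.
Qed.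

Lemma continuous_uniform_integral (f : boundary T -> R) :
  continuous f -> [bounded f x | x in [set: boundary T]] ->
  continuous (fun eta => \int[uniform_measure R eta]_x f x).
Proof.
move=> cf bf eta; have FF : Filter (nbhs eta) by exact: nbhs_filter.
apply/(@cvgrPdist_le R R^o (boundary (orbit_tree a)) (nbhs eta)) => e e0.
(* Half of [e], as [Rintegral_dist] spends the tolerance twice. *)
have e20 : 0 < e / 2 by exact: divr_gt0.
have [n fn] := boundary_unif_continuous T_finite cf e20.
have [zeta zE] := psi_boundary_surj eta; rewrite -zE.
have : nbhs (psi_boundary a zeta) (cylinder (psi a (zeta n) : orbit_tree a)).
  by apply: open_nbhs_nbhs; split; [exact: open_cylinder|exists n].
rewrite zE; apply: filterS => eta'; have [xi <-] := psi_boundary_surj eta'.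
rewrite -zE => -[m xz]; have {xz}zx : psi a (zeta n) = psi a (xi n).
  by rewrite -[LHS]xz -(level_psi_vertex_at (level_vertex_at zeta n) xz).
rewrite (splitr e); apply: Rintegral_dist fn _ => // v nv.
rewrite [LHS]uniform_measure_cylinder [RHS]uniform_measure_cylinder !indicE.
congr ((_ * (nat_of_bool _)%:R)%:E).
by apply/idP/idP; rewrite !(through_orbit_level a nv) !inE /= zx.
Qed.

Lemma continuous_uniform_measure : continuous (@uniform_measure R G T a).
Proof.
apply: continuous_comp_initial; apply: continuous_prod_topology => -[f fP].
by have [cf bf] := set_mem fP; exact: continuous_uniform_integral.
Qed.

Lemma continuous_through_orbit v :
  continuous (\1_(through_orbit a v) : boundary T -> R).
Proof.
apply/continuousP => A _; rewrite preimage_indic.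
have oE := open_through_orbit a v.
have oE' : open (~` through_orbit a v).
  by rewrite openC; exact: closed_through_orbit.
by case: ifP => _; case: ifP => _ //; [exact: openT|exact: open0].
Qed.

Lemma bounded_indic (X : Type) (A : set X) :
  [bounded (\1_A x : R) | x in [set: X]].
Proof.
exists 1; split=> // M M1 x _; rewrite /= indicE ger0_norm ?ler0n//.
by apply: le_trans (ltW M1); rewrite lern1 leq_b1.
Qed.

Definition through_orbit_indicator v : bounded_continuous (boundary T) R :=
  exist _ (\1_(through_orbit a v)) (mem_set
    (conj (@continuous_through_orbit v)
      (@bounded_indic _ (through_orbit a v)))).

Lemma integrals_through_orbit mu v :
  integrals mu (through_orbit_indicator v) = fine (mu (through_orbit a v)).
Proof.
rewrite /integrals /Rintegral/= integral_indic ?setIT//.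
exact: measurable_through_orbit.
Qed.

Lemma ergodic_through_orbitP mu v : ergodic_measures R a mu ->
  mu (through_orbit a v) = 1%E <->
  1 / 2 < integrals mu (through_orbit_indicator v).
Proof.
move=> /(ergodic_uniform_measure T_finite)[zeta ->].
rewrite integrals_through_orbit uniform_measure_through_orbit indicE.
case: (_ \in _) => /=; split=> //.
- by move=> _; lra.
- by move=> [] /esym/eqP; rewrite oner_eq0.
- by move=> ?; exfalso; lra.
Qed.

Lemma open_through_orbit_full v : open [set nu : ergodic_measures R a |
  (\val nu : borel_probability (boundary T) R) (through_orbit a v) = 1%E].
Proof.
pose K := fun _ : bounded_continuous (boundary T) R => (R : topologicalType).
pose p : prod_topology K -> R := @proj _ K (through_orbit_indicator v).
have -> : [set nu : ergodic_measures R a |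
    (\val nu : borel_probability (boundary T) R) (through_orbit a v) = 1%E] =
  set_val @^-1` (@integrals (boundary T) R @^-1`
    (p @^-1` `]1 / 2, +oo[)).
  apply/seteqP; split=> nu /=.
    move=> /(ergodic_through_orbitP v (set_mem (valP nu))).
    by rewrite in_itv/= andbT.
  rewrite in_itv/= andbT => nu2.
  exact/(ergodic_through_orbitP v (set_mem (valP nu))).
apply: open_comp => [+ _|]; first exact: initial_continuous.
apply: open_comp => [+ _|]; first exact: initial_continuous.
apply: open_comp => [+ _|]; first exact: (@proj_continuous _ K).
exact: interval_open.
Qed.

(** Measurability goes through the Dynkin induction together with the formula, since integrating
    over complements and disjoint unions requires it. On a cylinder, the formula says that [mu]
    divides the mass of an orbit set equally. *)
Lemma uniform_measure_integral mu : invariant_measures R a mu ->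
  forall A : set (borel (boundary T)), measurable A ->
  measurable_fun [set: borel (boundary T)] (fun xi : borel (boundary T) =>
    uniform_measure R (psi_boundary a xi) A) /\
  mu A = (\int[mu]_(xi in [set: borel (boundary T)])
    uniform_measure R (psi_boundary a xi) A)%E.
Proof.
move=> muG A mA.
pose U (B : set (borel (boundary T))) (xi : borel (boundary T)) :=
  uniform_measure R (psi_boundary a xi) B.
pose P (B : set (borel (boundary T))) := measurable_fun setT (U B) /\
  mu B = (\int[mu]_(xi in [set: borel (boundary T)]) U B xi)%E.
have U0 B xi : (0 <= U B xi)%E by exact: measure_ge0.
apply: (@dynkin_induction _ (borel (boundary T)) (@cylinders T) P) => //.
- exact: measurable_boundaryE.
- exact: cylindersI.
- have UT : U setT = cst 1%E by apply/funext => xi; exact: probability_setT.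
  rewrite /P UT; split; first exact: measurable_cst.
  by rewrite integral_cst// mul1e.
- move=> _ [->|[v _ <-]].
    have UE : U set0 = cst 0%E by apply/funext => xi; exact: measure0.
    rewrite /P UE measure0; split; first exact: measurable_cst.
    by rewrite integral_cst// mul0e.
  have UE : U (cylinder v) = (fun xi =>
      ((#|` fset_set (orbit_of a v)|%:R)^-1 * \1_(through_orbit a v) xi)%:E).
    by apply/funext => xi; exact: uniform_measure_cylinder.
  have mt := measurable_through_orbit a v.
  rewrite /P UE; split.
    by apply/measurable_EFinP/measurable_funM.
  under eq_integral do rewrite EFinM.
  rewrite ge0_integralZl_EFin//; last first.
    by apply/measurable_EFinP; exact: measurable_indic.
  rewrite integral_indic// setIT.
  have muv : mu (cylinder v) \is a fin_num.
    by apply: fin_num_measure; exact: measurable_cylinder.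
  rewrite [X in (_ * X)%E](measure_through_orbit T_finite
    (c := fine (mu (cylinder v)))) => [|w wv]; last first.
    by rewrite fineK//; exact: invariant_cylinder muG wv.
  rewrite -EFinM mulKf ?fineK// pnatr_eq0 -lt0n.
  exact: card_orbit_gt0.
- move=> B mB [mU muB]; have UC : U (~` B) = (fun xi => 1 - U B xi)%E.
    by apply/funext => xi; exact: probability_setC.
  have mUC : measurable_fun setT (U (~` B)).
    by rewrite UC; apply: emeasurable_funB => //; exact: measurable_cst.
  split=> //.
  have muBf : mu B \is a fin_num by exact: fin_num_measure.
  rewrite [LHS](probability_setC mu mB).
  (* Writing 1 as a sum of two integrals replaces the integral of a difference by that of a sum of
     nonnegative functions. *)
  have <- : ((\int[mu]_(xi in [set: borel (boundary T)]) U (~` B) xi) + mu B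
      = 1)%E.
    rewrite [X in (_ + X)%E]muB -ge0_integralD//.
    rewrite (eq_integral (cst 1%E)) => [|xi _]; last first.
      by rewrite UC /= subeK// fin_num_measure.
    by rewrite integral_cst// mul1e; exact: probability_setT.
  by rewrite addeK.
- move=> F mF tF FP.
  have UU : U (\bigcup_k F k) = (fun xi => \sum_(k <oo) U (F k) xi)%E.
    apply/funext => xi; rewrite [LHS]measure_bigcup//.
    by apply: eq_eseriesl => k; rewrite in_setT.
  split.
    rewrite UU; apply: ge0_emeasurable_sum => // k _; exact: (FP k).1.
  rewrite UU integral_nneseries// => [|k]; last exact: (FP k).1.
  rewrite [LHS]measure_bigcup//.
  rewrite (eq_eseriesl (Q := xpredT)) => [|k]; last by rewrite in_setT.
  by apply: eq_eseriesr => k _; exact: (FP k).2.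
- by rewrite -measurable_boundaryE.
Qed.

End ErgodicDecomposition.

Theorem theorem2p2 (R : realType) (G : topologicalGroupType) (T : rootedTree)
    (a : treeAction G T)
    (HG : countable_discrete G \/ profinite G)
    (a_continuous : continuous_action a)
    (a_faithful : faithful a)
    (T_homogeneous : spherically_homogeneous T)
    (T_finite : finite_levels T) :
  let X := boundary T in
  let Y := boundary (orbit_tree a) in
  let mu_ : Y -> borel_probability X R := @uniform_measure R G T a in
  let MG := invariant_measures R a in
  let MeG := ergodic_measures R a in
  (forall eta : Y, uniform_on R eta = [set mu_ eta] /\
     measure_support (mu_ eta) = subtree_boundary eta) /\
  (forall eta : Y, MeG (mu_ eta)) /\
  exists beta : Y -> MeG,
    [/\ forall eta : Y, \val (beta eta) = mu_ eta,
        homeomorphism beta &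
        let pi_ : X -> MeG := beta \o psi_boundary a in
        [/\ forall B : set MeG, <<s @open MeG >> B ->
              measurable (pi_ @^-1` B : set (borel X)),
            forall nu : MeG, exists xi : X, pi_ xi = nu,
            forall (g : G) (xi : X), pi_ (act_boundary a g xi) = pi_ xi,
            forall nu : MeG,
              let X_nu : set X := [set xi | pi_ xi = nu] in
              (\val nu : borel_probability X R) X_nu = 1%E /\
              forall mu : borel_probability X R,
                MG mu -> mu X_nu = 1%E -> mu = \val nu &
            forall mu : borel_probability X R, MG mu ->
              forall A : set (borel X), measurable A ->
                measurable_fun [set: borel X]
                  (fun xi : borel X => (\val (pi_ xi) : borel_probability X R) A)
                /\
                mu A = (\int[mu]_(xi in [set: borel X])
                          (\val (pi_ xi) : borel_probability X R) A)%E]].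
Proof.
move=> X Y mu_ MG MeG.
have mu_erg eta : MeG (mu_ eta) := uniform_measure_ergodic R T_finite eta.
split=> [eta|].
  split; last exact: uniform_measure_support.
  apply/seteqP; split=> [mu /uniform_measure_unique|_ ->]; first exact.
  exact: uniform_measureP.
split=> //.
pose beta (eta : Y) : MeG := exist _ (mu_ eta) (mem_set (mu_erg eta)).
have betaE zeta (nu : MeG) : beta (psi_boundary a zeta) = nu <->
    \val nu = mu_ (psi_boundary a zeta).
  by split=> [<-//|nuE]; apply/val_inj; rewrite nuE.
have beta_continuous : continuous beta.
  by apply: continuous_comp_initial; exact: continuous_uniform_measure.
have ergP (nu : MeG) : exists zeta, \val nu = mu_ (psi_boundary a zeta).
  by apply: ergodic_uniform_measure => //; exact: set_mem (valP nu).
exists beta; split=> //.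
- split=> //.
  (* The inverse projects any ray whose uniform measure is [nu]; injectivity of [uniform_measure]
     makes the choice immaterial. *)
  pose g nu := psi_boundary a (projT1 (cid (ergP nu))).
  exists g; rewrite /g; split.
  + move=> eta; case: cid => zeta /= /(uniform_measure_inj T_finite).
    by move=> ->.
  + by move=> nu; case: cid => zeta /= /betaE.
  + apply: continuous_cylinder => O; have [v <-] := psi_surj O.
    (* Under the inverse, passing through the orbit of [v] becomes giving mass 1 to its orbit set,
       an open condition on ergodic measures. *)
    rewrite -/g; have -> : g @^-1` cylinder (psi a v : orbit_tree a) =
      [set nu : MeG |
        (\val nu : borel_probability X R) (through_orbit a v) = 1%E].
      apply/seteqP; split=> nu; rewrite /g /=; case: cid => zeta /= zE vz.
        rewrite zE uniform_measure_through_orbit// indicE mem_set//.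
      move: vz; rewrite zE uniform_measure_through_orbit// indicE.
      case: (boolP (zeta \in _)) => [/set_mem//|_ [] /esym/eqP].
      by rewrite oner_eq0.
    exact: open_through_orbit_full.
- move=> pi_; have pi_continuous : continuous pi_.
    move=> xi; apply: continuous_comp; first exact: continuous_psi_boundary.
    exact: beta_continuous.
  have fiberE zeta : [set xi | pi_ xi = beta (psi_boundary a zeta)] =
      [set xi | psi_boundary a xi = psi_boundary a zeta].
    apply/seteqP; split=> xi /= E; last by rewrite /pi_ /= E.
    exact: uniform_measure_inj T_finite _ _ (congr1 (@sval _ _) E).
  split.
  (* Sets with Borel preimage form a sigma-algebra, which contains the open sets because [pi_] is
     continuous. *)
  + pose S := [set B : set MeG | measurable (pi_ @^-1` B : set (borel X))].
    suff sS : <<s @open MeG >> `<=` S by move=> B /sS.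
    apply: smallest_sub => [|U oU]; last first.
      by apply: sub_sigma_algebra; have /continuousP := pi_continuous; exact.
    split=> [|B' mB'|F mF]; first by rewrite /S /= preimage_set0.
      by rewrite /S /= setTD preimage_setC; exact: measurableC.
    by rewrite /S /= preimage_bigcup; exact: bigcupT_measurable.
  + by move=> nu; have [zeta /betaE] := ergP nu; exists zeta.
  + by move=> g xi; rewrite /pi_ /= psi_boundary_act.
  + move=> nu X_nu; have [zeta zE] := ergP nu.
    have XE : X_nu = [set xi | psi_boundary a xi = psi_boundary a zeta].
      rewrite -fiberE; congr (fun b => [set xi | pi_ xi = b]).
      exact/esym/betaE.
    rewrite XE; split; first by rewrite zE; exact: uniform_measure_fiber.
    (* Every orbit set of [zeta] contains [X_nu] and so inherits mass 1, which determines an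
       invariant measure. *)
    move=> mu muG mu1; rewrite zE; apply: invariant_uniform_measure => // n.
    have mt := measurable_through_orbit a (zeta n).
    apply/eqP; rewrite eq_le probability_le1//=.
    rewrite -mu1; apply: le_measure; rewrite ?inE.
    * rewrite psi_boundary_fiber; apply: bigcapT_measurable => k.
      exact: measurable_through_orbit.
    * exact: mt.
    * by rewrite psi_boundary_fiber => xi; apply.
  + by move=> mu muG A mA; exact: uniform_measure_integral.
Qed.
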